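(* Let $\lambda$ be a partition with Frobenius notation $\lambda=(p_1,\ldots,p_N\mid q_1,\ldots,q_N)$. Let $(z_k)_k$ be complex numbers indexed by the contents $k$ of boxes of $\lambda$, with $\Re(z_k)\ge 1$ for all such $k$ and $\Re(z_{p_i})>1$, $\Re(z_{-q_i})>1$ for all $1\le i\le N$, and let ${\pmb s}=(s_{ij})$ be the filling of $\lambda$ with $s_{ij}=z_{j-i}$. Then $$\zeta_\lambda({\pmb s})=\sum_{m_1,\ldots,m_N\ge 1}(m_1\cdots m_N)^{-z_0}\sum_{\sigma\in\mathfrak{S}_N}\mathrm{sgn}(\sigma)\prod_{k=1}^{N}\zeta^{\bullet,H}_{p_k,p_k}\big((z_1,\ldots,z_{p_k}),m_{\sigma(k)},A_{p_k}\big)\prod_{j=1}^{N}\zeta^{H}_{q_j}\big((z_{-1},\ldots,z_{-q_j}),m_j,A_{q_j}\big),$$ where $\mathfrak{S}_N$ is the symmetric group on $\{1,\dots,N\}$.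
   Context: For a partition $\lambda$ with conjugate $\lambda'$, let $N$ be the number of boxes on the main diagonal; its Frobenius notation is $\lambda=(p_1,\ldots,p_N\mid q_1,\ldots,q_N)$ with $p_i=\lambda_i-i$, $q_i=\lambda'_i-i$. $\mathrm{SSYT}(\lambda)$ is the set of fillings $M=(m_{ij})$ of the Young diagram by positive integers, weakly increasing along rows and strictly increasing down columns; for a filling ${\pmb s}=(s_{ij})$ by complex numbers, $\zeta_\lambda({\pmb s})=\sum_{M\in\mathrm{SSYT}(\lambda)}\prod_{(i,j)\in\lambda}m_{ij}^{-s_{ij}}$. The content of box $(i,j)$ is $j-i$. For $r\ge 0$, $x>0$ and $(w_1,\dots,w_r)\in\mathbb{C}^r$, define $\zeta^{\bullet,H}_{r,r}((w_1,\ldots,w_r),x,A_r)=\sum_{a_1,\ldots,a_r\ge 0}\prod_{j=1}^{r}(x+a_1+\cdots+a_j)^{-w_j}$ and $\zeta^{H}_{r}((w_1,\ldots,w_r),x,A_r)=\sum_{b_1,\ldots,b_r\ge 1}\prod_{j=1}^{r}(x+b_1+\cdots+b_j)^{-w_j}$, both equal to $1$ when $r=0$. (These are Hurwitz-type modified zeta-functions of the root system $A_r$, $\sum\prod_{1\le i<j\le r+1}(x+m_i+\cdots+m_{j-1})^{-s(i,j)}$ with all $m_i\ge 0$, resp. all $m_i\ge1$, specialized to $s(1,j+1)=w_j$ and other $s(i,j)=0$.) *)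

(* Defs.v *)
From Stdlib Require Import Reals ZArith ClassicalEpsilon.
From Coquelicot Require Import Coquelicot.
From mathcomp Require Import all_boot all_fingroup.

Set Implicit Arguments.
Unset Strict Implicit.
Unset Printing Implicit Defensive.

Local Open Scope R_scope.


Definition csum {X : Type} (F : seq X) (f : X -> C) : C :=
  foldr (fun x acc => Cplus (f x) acc) (RtoC 0) F.
Definition cprod {X : Type} (F : seq X) (f : X -> C) : C :=
  foldr (fun x acc => Cmult (f x) acc) (RtoC 1) F.

(** x^(-w) for a real x > 0 and complex w : exp(-w log x) *)
Definition cnpow (x : R) (w : C) : C :=
  let L := ln x in
  Cmult (RtoC (exp (- (Re w) * L))) (cos (Im w * L), (- sin (Im w * L))).

Definition HasSum {X : eqType} (P : pred X) (f : X -> C) (S : C) : Prop :=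
  forall eps : R, (0 < eps) ->
    exists F0 : seq X, all P F0 /\
      forall F : seq X, uniq F -> all P F -> {subset F0 <= F} ->
        (Cmod (Cminus (csum F f) S) < eps).

Definition Summable {X : eqType} (P : pred X) (f : X -> C) : Prop :=
  exists S, HasSum P f S.

Definition usum {X : eqType} (P : pred X) (f : X -> C) : C :=
  epsilon (inhabits (RtoC 0)) (HasSum P f).

(** ** Partitions (0-indexed rows/columns internally) *)
Definition is_partition (la : seq nat) : bool :=
  sorted geq la && all (fun x => 0 < x)%N la.

Definition conj_part (la : seq nat) (c : nat) : nat := count (fun x => c < x)%N la.

Definition frobN (la : seq nat) : nat :=
  count (fun i => i < nth 0%N la i)%N (iota 0%N (size la)).

(** Frobenius coordinates, 0-indexed: p_(i+1) = la_(i+1) - (i+1) etc. *)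
Definition frob_p (la : seq nat) (i : nat) : nat := (nth 0%N la i - i.+1)%N.
Definition frob_q (la : seq nat) (i : nat) : nat := (conj_part la i - i.+1)%N.

Definition content (i j : nat) : Z := (Z.of_nat j - Z.of_nat i)%Z.

Definition in_diagram (la : seq nat) (i j : nat) : bool := (j < nth 0%N la i)%N.

Definition entry (T : seq (seq nat)) (i j : nat) : nat := nth 0%N (nth [::] T i) j.

Definition is_SSYT (la : seq nat) (T : seq (seq nat)) : bool :=
  [&& size T == size la,
      all (fun i => size (nth [::] T i) == nth 0%N la i) (iota 0%N (size la)),
      all (fun i => all (fun j => 0 < entry T i j)%N (iota 0%N (nth 0%N la i)))
          (iota 0%N (size la)),
      all (fun i => all (fun j => entry T i j <= entry T i j.+1)%N
                          (iota 0%N (nth 0%N la i).-1)) (iota 0%N (size la)) &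
      all (fun i => all (fun j => entry T i j < entry T i.+1 j)%N
                          (iota 0%N (nth 0%N la i.+1))) (iota 0%N (size la).-1)].

Definition schur_summand (la : seq nat) (z : Z -> C) (T : seq (seq nat)) : C :=
  cprod (iota 0%N (size la)) (fun i =>
    cprod (iota 0%N (nth 0%N la i)) (fun j =>
      cnpow (INR (entry T i j)) (z (content i j)))).

Definition psum (a : seq nat) (j : nat) : nat := sumn (take j.+1 a).

Definition zetaBH_summand (r : nat) (w : nat -> C) (x : R) (a : seq nat) : C :=
  cprod (iota 0%N r) (fun j => cnpow (x + INR (psum a j)) (w j.+1)).
Definition zetaBH_dom (r : nat) : pred (seq nat) := fun a => size a == r.
Definition zetaBH (r : nat) (w : nat -> C) (x : R) : C :=
  usum (zetaBH_dom r) (zetaBH_summand r w x).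

Definition zetaH_dom (r : nat) : pred (seq nat) :=
  fun b => (size b == r) && all (fun x => 0 < x)%N b.
Definition zetaH (r : nat) (w : nat -> C) (x : R) : C :=
  usum (zetaH_dom r) (zetaBH_summand r w x).

Definition sgnC {n : nat} (s : 'S_n) : C := if odd_perm s then RtoC (-1) else RtoC 1.

Definition pos_tuple_dom (N : nat) : pred (seq nat) :=
  fun m => (size m == N) && all (fun x => 0 < x)%N m.

Definition rhs_summand (la : seq nat) (z : Z -> C) (m : seq nat) : C :=
  let N := frobN la in
  Cmult (cnpow (INR (foldr muln 1%N m)) (z 0%Z))
   (Cmult
    (csum (enum [set: 'S_N]) (fun s =>
       Cmult (sgnC s)
         (cprod (enum 'I_N) (fun k =>
            zetaBH (frob_p la k) (fun j => z (Z.of_nat j))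
                   (INR (nth 0%N m (s k)))))))
    (cprod (iota 0%N N) (fun j =>
        zetaH (frob_q la j) (fun i => z (- Z.of_nat i)%Z) (INR (nth 0%N m j))))).

(* Main.v *)
(** Read a tableau diagonal by diagonal.  If [m] is its (strictly increasing)
    main diagonal, then the part above [m] and the part below [m] are chosen
    independently, and two neighbouring diagonals [b], [a] (going outwards)
    satisfy [b_i + d <= a_i < b_(i+1) + d], with [d = 0] above and [d = 1] below.
    Summing over [a] a determinant in the entries of [a] replaces each row by a
    sum over a gap, i.e. by a difference of two consecutive tails, so it is the
    same determinant in the tails, by row operations; one size is lost whenever a
    Frobenius coordinate is exhausted.  Hence, for entries at most [n], the two
    parts sum to determinants of truncated [zetaBH], resp. [zetaH], and since
    every injective word is a permutation of one increasing word, the sum over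
    increasing [m] of both determinants is a sum over all [m] of one determinant
    times a diagonal product.  Expanded over permutations this is a signed sum of
    products of truncated hook sums.  The identity holds for arbitrary weights, so
    with absolute values of the weights it bounds the absolute sums; then one lets
    [n] tend to infinity, using dominated convergence for the hook sums. *)

Require Import Defs.
From HB Require Import structures.
From Stdlib Require Import Reals ZArith Lra.
From Coquelicot Require Import Coquelicot.
From mathcomp Require Import all_boot all_fingroup all_algebra.
From mathcomp Require Import boolp zify.
Import GRing.Theory.

Set Implicit Arguments.
Unset Strict Implicit.
Unset Printing Implicit Defensive.

Local Open Scope nat_scope.

(** * Cartesian products and determinants *)

Fixpoint cart (Is : seq (seq nat)) : seq (seq nat) :=
  if Is is J :: Js then [seq v :: a | v <- J, a <- cart Js] else [:: [::]].

Lemma cartP (Is : seq (seq nat)) (a : seq nat) :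
  reflect (size a = size Is /\
           forall k, k < size Is -> nth 0 a k \in nth [::] Is k)
          (a \in cart Is).
Proof.
elim: Is a => [|J Is IH] a /=.
  by rewrite inE; apply: (iffP eqP) => [-> //|[/size0nil ->]].
apply: (iffP allpairsPdep) => [[v [a' [vJ /IH[sa' Ha'] ->]]]|[]].
  by split=> [|[|k] //= /Ha']; rewrite //= sa'.
case: a => [//|v a] /= [sa] Ha; exists v, a; split=> //; first exact: (Ha 0).
by apply/IH; split=> // k lt_k; apply: (Ha k.+1).
Qed.

Lemma cart_uniq (Is : seq (seq nat)) : all uniq Is -> uniq (cart Is).
Proof.
elim: Is => [//|J Is IH] /= /andP[uJ /IH uIs].
apply: allpairs_uniq_dep => // -[v a] [w b] _ _ /=.
by case=> -> ->.
Qed.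

Section SlicesAlgebra.

Local Open Scope ring_scope.
Variable R : comNzRingType.

Lemma sum_cart_prod (Is : seq (seq nat)) (g : nat -> nat -> R) :
  \sum_(a <- cart Is) \prod_(j < size Is) g j (nth 0%N a j) =
  \prod_(j < size Is) \sum_(v <- nth [::] Is j) g j v.
Proof.
elim: Is g => [|J Is IH] g /=; first by rewrite big_seq1 !big_ord0.
rewrite big_allpairs_dep big_ord_recl /= -(IH (fun j => g j.+1)) mulr_suml.
apply: eq_bigr => v _; rewrite mulr_sumr; apply: eq_bigr => a _.
by rewrite big_ord_recl.
Qed.

(** Multilinearity of the determinant in its rows: expanding every row sum chooses one [v] per row,
    that is, a word [a] of the product. *)
Lemma det_sum_cart r (Is : seq (seq nat)) (x : nat -> R) (g : nat -> nat -> R) :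
  size Is = r ->
  \det (\matrix_(j < r, k < r) \sum_(v <- nth [::] Is j) x v * g k v) =
  \sum_(a <- cart Is) (\prod_(v <- a) x v) *
     \det (\matrix_(j < r, k < r) g k (nth 0%N a j)).
Proof.
move=> <-{r}; rewrite /determinant.
under [RHS]eq_bigr do rewrite mulr_sumr.
rewrite exchange_big /=; apply: eq_bigr => s _.
(* [sum_cart_prod] takes factors indexed by all naturals, so the ordinal [s j] is read through
   [insub]; the default 0 concerns only indices outside the matrix. *)
pose h (s : 'S_(size Is)) (j : nat) v := x v * g (oapp (fun i => val (s i)) 0%N (insub j)) v.
have hE (j : 'I_(size Is)) v : h s j v = x v * g (s j) v.
  by rewrite /h valK.
transitivity ((-1) ^+ s *
    \prod_(j < size Is) \sum_(v <- nth [::] Is j) h s j v).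
  congr (_ * _); apply: eq_bigr => j _; rewrite mxE.
  by apply: eq_bigr => v _; rewrite hE.
rewrite -sum_cart_prod mulr_sumr big_seq [RHS]big_seq.
apply: eq_bigr => a /cartP[sa _]; rewrite mulrCA; congr (_ * _).
rewrite (big_nth 0%N) sa big_mkord -big_split /=.
by apply: eq_bigr => j _; rewrite mxE hE.
Qed.

(** The row operation is left multiplication by a unitriangular matrix, with -1 just above the
    diagonal. The last row has no successor and is kept. *)
Lemma det_sub_next_row r (g : nat -> nat -> R) :
  \det (\matrix_(j < r, k < r) g j k) =
  \det (\matrix_(j < r, k < r) (g j k - (if (j.+1 < r)%N then g j.+1 k else 0))).
Proof.
pose L : 'M[R]_r := \matrix_(i, j) ((i == j)%:R - (j == i.+1 :> nat)%:R).
have detL : \det L = 1.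
  rewrite -det_tr det_trig; last first.
    apply/is_trig_mxP => i j lt_ij; rewrite !mxE.
    have -> : (j == i) = false by apply/eqP => ji; rewrite ji ltnn in lt_ij.
    have -> : (i == j.+1 :> nat) = false by apply/eqP; lia.
    by rewrite subrr.
  rewrite big1 // => i _; rewrite !mxE eqxx.
  have -> : (i == i.+1 :> nat) = false by apply/eqP; lia.
  by rewrite subr0.
rewrite -[LHS]mul1r -detL -det_mulmx; congr (\det _).
apply/matrixP => i k; rewrite !mxE.
under eq_bigr do rewrite !mxE mulrBl.
rewrite sumrB; congr (_ - _).
  rewrite (bigD1 i) //= eqxx mul1r big1 ?addr0 // => j ne_ji.
  by rewrite eq_sym (negbTE ne_ji) mul0r.
case: ifP => lt_ir.
  rewrite (bigD1 (Ordinal lt_ir)) //= eqxx mul1r big1 ?addr0 // => j ne_ji.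
  suff -> : (j == i.+1 :> nat) = false by rewrite mul0r.
  by apply: contraNF ne_ji => /eqP ji; apply/eqP/val_inj.
rewrite big1 // => j _; suff -> : (j == i.+1 :> nat) = false by rewrite mul0r.
by apply/eqP => ji; have := ltn_ord j; rewrite ji lt_ir.
Qed.

(** Expansion along the last column, which is a unit vector. This is how a determinant shrinks by
    one when a coordinate is exhausted. *)
Lemma det_last_col_delta r (g : nat -> nat -> R) :
  (forall j, (j < r)%N -> g j r = 0) -> g r r = 1 ->
  \det (\matrix_(j < r.+1, k < r.+1) g j k) = \det (\matrix_(j < r, k < r) g j k).
Proof.
move=> g0 g1; rewrite (expand_det_col _ ord_max) (bigD1 ord_max) //=.
rewrite big1 ?addr0 => [|i ne_i]; last first.
  rewrite mxE g0 ?mul0r //; have := ltn_ord i.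
  by rewrite ltnS leq_eqVlt => /predU1P[ir|//]; case/eqP: ne_i; apply/val_inj.
rewrite mxE /= g1 mul1r /cofactor /= addnn -signr_odd odd_double mul1r.
by congr (\det _); apply/matrixP => j k; rewrite !mxE !lift_max.
Qed.

End SlicesAlgebra.

(** * Peeling off diagonals *)

(** The last entry of [b] has no right neighbour, so its gap ends at the global bound [n], with no
    shift by [d]. With [r = size b - 1] this open gap does not occur. *)
Definition gaps (d n r : nat) (b : seq nat) : seq (seq nat) :=
  [seq index_iota (nth 0 b k + d)
         (if k.+1 < size b then nth 0 b k.+1 + d else n.+1) | k <- iota 0 r].

Lemma size_gaps d n r b : size (gaps d n r b) = r.
Proof. by rewrite size_map size_iota. Qed.

Lemma nth_gaps d n r b k : k < r -> nth [::] (gaps d n r b) k =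
  index_iota (nth 0 b k + d) (if k.+1 < size b then nth 0 b k.+1 + d else n.+1).
Proof. by move=> lt_kr; rewrite (nth_map 0) ?size_iota // nth_iota. Qed.

Lemma cart_gapsP d n r (b a : seq nat) :
  reflect (size a = r /\ forall k, k < r -> nth 0 b k + d <= nth 0 a k <
             (if k.+1 < size b then nth 0 b k.+1 + d else n.+1))
          (a \in cart (gaps d n r b)).
Proof.
apply: (iffP (cartP _ _)); rewrite size_gaps => -[sa Ha]; split=> // k lt_kr.
  by have := Ha k lt_kr; rewrite nth_gaps // mem_index_iota.
by rewrite nth_gaps // mem_index_iota Ha.
Qed.

(** [b] is the diagonal at distance [c] from the main one; [D] lists the next [P] diagonals
    outwards, and [r] prescribes their lengths. *)
Fixpoint slices (d n : nat) (r : nat -> nat) (P c : nat) (b : seq nat) :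
    seq (seq (seq nat)) :=
  if P is P'.+1 then
    [seq a :: D | a <- cart (gaps d n (r c.+1) b), D <- slices d n r P' c.+1 a]
  else [:: [::]].

Lemma slicesP d n r P c b D :
  reflect (size D = P /\ forall t, t < P ->
             nth [::] D t \in cart (gaps d n (r (c + t).+1) (nth [::] (b :: D) t)))
          (D \in slices d n r P c b).
Proof.
elim: P c b D => [|P IH] c b D /=.
  by rewrite inE; apply: (iffP eqP) => [-> //|[/size0nil ->]].
apply: (iffP allpairsPdep) => [[a [D' [aI /IH[sD HD] ->]]]|[]].
  split=> /= [|[|t] lt_t /=]; rewrite ?sD ?addn0 //.
  by rewrite addnS -addSn; apply: HD.
case: D => [//|a D] /= [sD] HD; exists a, D; split=> //.
  by have := HD 0 isT; rewrite addn0.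
by apply/IH; split=> // t lt_t; have := HD t.+1 lt_t; rewrite /= addnS -addSn.
Qed.

Lemma slices_uniq d n r P c b : uniq (slices d n r P c b).
Proof.
elim: P c b => [//|P IH] c b /=; apply: allpairs_uniq_dep => //.
  by apply/cart_uniq/allP => _ /mapP[k _ ->]; apply: iota_uniq.
by move=> -[v a] [w e] _ _ /= [-> ->].
Qed.

(** For a list of Frobenius coordinates this is the length of the diagonal at distance [c] from the
    main one. *)
Definition rank (p : seq nat) (c : nat) : nat := count (leq c) p.

Lemma ltn_rank p c k : sorted gtn p ->
  (k < rank p c) = (k < size p) && (c <= nth 0 p k).
Proof.
rewrite /rank; elim: p k => [|x p IH] k srt /=; first by rewrite ltn0.
have {}IH := IH _ (path_sorted srt).
have lt_px : all (gtn x) p.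
  by apply: order_path_min srt => y u v /= h1 h2; apply: ltn_trans h2 h1.
case: (leqP c x) => [le_cx|lt_xc]; first by case: k => [|k] //=; rewrite add1n !ltnS.
have -> : count (leq c) p = 0.
  apply/eqP; rewrite -leqn0 leqNgt -has_count; apply/hasPn => y /(allP lt_px) /= lt_yx.
  by rewrite -ltnNge (ltn_trans lt_yx).
rewrite ltn0; case: k => [|k] /=; first by rewrite leqNgt lt_xc.
rewrite ltnS; case: ltnP => //= lt_k; have /= := allP lt_px _ (mem_nth 0 lt_k).
by lia.
Qed.

(** Strict decrease lets [c] occur at most once, and then right after the coordinates exceeding it.
    So neighbouring diagonals differ in length by at most one. *)
Lemma rank_succ p c : sorted gtn p ->
  rank p c = rank p c.+1 \/
  rank p c = (rank p c.+1).+1 /\ nth 0 p (rank p c.+1) = c.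
Proof.
move=> srt; have H1 := fun k => ltn_rank c k srt.
have H2 := fun k => ltn_rank c.+1 k srt.
have srt' k : k.+1 < size p -> nth 0 p k.+1 < nth 0 p k.
  by move=> lt_k; apply: (sortedP 0 srt).
have le12 : rank p c.+1 <= rank p c.
  by apply: sub_count => x /=; apply: leq_trans (leqnSn c).
move: (H1 (rank p c.+1)) (H2 (rank p c.+1)); rewrite ltnn.
move: (H1 (rank p c.+1).+1) (srt' (rank p c.+1)).
by lia.
Qed.

Section SlicesDet.

Local Open Scope ring_scope.
Variables (R : comNzRingType) (d n : nat) (X : nat -> nat -> R).

(** The sum over words [a_1, ..., a_e] with steps at least [d], starting from [v] and bounded by
    [n], of the product of the [X (c + i) a_i]: a truncated [zetaBH] for [d = 0], a truncated
    [zetaH] for [d = 1]. *)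
Fixpoint chain (e c v : nat) : R :=
  if e is e'.+1 then \sum_(v + d <= a < n.+1) X c.+1 a * chain e' c.+1 a else 1.

Fixpoint slices_weight (c : nat) (D : seq (seq nat)) : R :=
  if D is a :: D' then (\prod_(v <- a) X c.+1 v) * slices_weight c.+1 D' else 1.

(** Induction on the number [P] of diagonals still to be summed. The induction hypothesis treats
    everything beyond the first of them, and that one is summed by multilinearity. *)
Lemma slices_det (p : seq nat) (P c : nat) (b : seq nat) :
  (d <= 1)%N -> sorted gtn p -> all (gtn (c + P)%N) p ->
  sorted leq b -> all (geq n) b -> size b = rank p c ->
  \sum_(D <- slices d n (rank p) P c b) slices_weight c D =
  \det (\matrix_(j < rank p c, k < rank p c) chain (nth 0 p k - c) c (nth 0 b j))%N.
Proof.
move=> d_le1 srt; elim: P c b => [|P IH] c b.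
  rewrite addn0 => lt_pc _ _ _; rewrite big_seq1 /=.
  (* All coordinates lie below [c], so the determinant has size 0 and equals the empty product. *)
  suff -> : rank p c = 0%N by rewrite det_mx00.
  apply/eqP; rewrite -leqn0 leqNgt -has_count; apply/hasPn => x /(allP lt_pc) /=.
  by rewrite ltnNge.
rewrite addnS -addSn => lt_pc srt_b le_bn sb; rewrite /= big_allpairs_dep /=.
set r := rank p c; set r' := rank p c.+1.
have rr' : r = r' \/ r = r'.+1 /\ nth 0%N p r' = c := rank_succ c srt.
rewrite -/r in sb.
have le_b k : (k < size b)%N -> (nth 0 b k <= n)%N.
  by move=> lt_k; apply: (allP le_bn); apply: mem_nth.
pose g k v := chain (nth 0 p k - c)%N c v.
pose g' k v := chain (nth 0 p k - c.+1)%N c.+1 v.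
transitivity (\sum_(a <- cart (gaps d n r' b)) (\prod_(v <- a) X c.+1 v) *
                \det (\matrix_(j < r', k < r') g' k (nth 0%N a j))).
  rewrite big_seq [RHS]big_seq; apply: eq_bigr => a /cart_gapsP[sa Ha].
  have le_r'b : (r' <= size b)%N by rewrite sb; case: rr' => [->|[-> _]].
  rewrite -mulr_sumr; congr (_ * _); apply: IH => //.
    (* Interlacing with [b] orders [a]: [a_k < b_(k+1) + d <= a_(k+1)]. *)
    apply/(sortedP 0%N) => k; rewrite sa => lt_k; move: (Ha k (ltnW lt_k)) (Ha k.+1 lt_k).
    rewrite (leq_trans lt_k le_r'b) => /andP[_ lt_a] /andP[le_a _].
    by apply: leq_trans (ltnW lt_a) le_a.
  apply/(all_nthP 0%N) => k; rewrite sa => lt_k; have /andP[_] := Ha k lt_k => /=.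
  by case: ifP => // /le_b; lia.
rewrite -det_sum_cart ?size_gaps //.
have tailE k j : (k < r')%N -> (j < r)%N ->
    g k (nth 0 b j)%N = \sum_(nth 0%N b j + d <= a < n.+1) X c.+1 a * g' k a.
  rewrite /g /g' ltn_rank // => /andP[_ lt_c] _.
  by rewrite -[(nth 0 p k - c)%N](subnSK lt_c).
have gapE k j : (k < r')%N -> (j < r')%N -> (r' <= r)%N ->
    \sum_(v <- nth [::] (gaps d n r' b) j) X c.+1 v * g' k v =
    g k (nth 0 b j)%N - (if (j.+1 < r)%N then g k (nth 0 b j.+1)%N else 0).
  move=> lt_k lt_j le_r'; have lt_jr := leq_trans lt_j le_r'.
  rewrite nth_gaps // sb tailE //; case: ifP => lt_j1; last by rewrite subr0.
  have le_bb : (nth 0 b j <= nth 0 b j.+1)%N by apply: (sortedP 0%N srt_b); rewrite sb.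
  have := le_b j.+1; rewrite sb => /(_ lt_j1) le_jn.
  (* A gap is the difference of the tails from [b_j + d] and from [b_(j+1) + d]. The splitting point
     is at most [n + 1] because [d <= 1]. *)
  rewrite tailE // [X in _ = X - _](@big_cat_nat _ _ _ (nth 0 b j.+1 + d)%N) //=.
  - by rewrite addrK.
  - by rewrite leq_add2r.
  - by move: d_le1 le_jn; lia.
transitivity (\det (\matrix_(j < r', k < r')
    (g k (nth 0 b j)%N - (if (j.+1 < r)%N then g k (nth 0 b j.+1)%N else 0)))).
  congr (\det _); apply/matrixP => j k; rewrite !mxE gapE ?ltn_ord //.
  by case: rr' => [->|[-> _]].
rewrite [RHS](det_sub_next_row r (fun j k => g k (nth 0 b j)%N)) {gapE tailE}.
case: rr' => [rE|[rE pE]]; first by rewrite -!rE.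
(* Here coordinate [r'] equals [c]: its chain is empty, so its column is constantly 1 and becomes
   the last unit vector after subtracting successive rows. *)
clear sb; clearbody r; subst r.
have g1 v : g r' v = 1 by rewrite /g pE subnn.
symmetry; apply: (det_last_col_delta (g := fun j k =>
  g k (nth 0 b j)%N - (if (j.+1 < r'.+1)%N then g k (nth 0 b j.+1)%N else 0))).
- by move=> j lt_j; rewrite ltnS lt_j !g1 subrr.
- by rewrite ltnn g1 subr0.
Qed.

End SlicesDet.

(** * From increasing words to all words *)

Definition perm_seq N (s : 'S_N) (m : seq nat) : seq nat :=
  [seq nth 0 m (s i) | i <- enum 'I_N].

Lemma size_perm_seq N (s : 'S_N) m : size (perm_seq s m) = N.
Proof. by rewrite size_map size_enum_ord. Qed.

Lemma nth_perm_seq N (s : 'S_N) m (i : 'I_N) : nth 0 (perm_seq s m) i = nth 0 m (s i).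
Proof. by rewrite (nth_map i) ?size_enum_ord // nth_ord_enum. Qed.

Lemma perm_seqK N (s : 'S_N) m : size m = N -> perm_seq s^-1 (perm_seq s m) = m.
Proof.
move=> sm; apply: (@eq_from_nth _ 0) => [|i]; rewrite size_perm_seq ?sm // => lt_i.
by rewrite -[i]/(val (Ordinal lt_i)) !nth_perm_seq permKV.
Qed.

Lemma perm_seq_perm_eq N (s : 'S_N) m : size m = N -> perm_eq (perm_seq s m) m.
Proof.
move=> sm; have -> : m = tval (Tuple (introT eqP sm)) by [].
apply/tuple_permP; exists s; rewrite /perm_seq /=; apply: eq_map => i.
by rewrite (tnth_nth 0).
Qed.

(** Sorting provides [s0]. A sorted list is determined by its letters, and distinct letters then
    determine the permutation. *)
Lemma perm_seq_sort N m : size m = N -> uniq m ->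
  exists s0 : 'S_N, forall s : 'S_N, sorted ltn (perm_seq s m) = (s == s0).
Proof.
move=> sm um; pose t := Tuple (introT eqP sm).
have : perm_eq (sort leq m) t by rewrite perm_sort.
case/tuple_permP => s0 srtE.
have {}srtE : sort leq m = perm_seq s0 m.
  by rewrite srtE; apply: eq_map => i; rewrite (tnth_nth 0).
exists s0 => s; apply/idP/eqP => [srt|->]; last first.
  by rewrite -srtE ltn_sorted_uniq_leq sort_uniq um sort_sorted //; apply: leq_total.
have eq_ss : perm_seq s m = perm_seq s0 m.
  apply: (sorted_eq leq_trans anti_leq).
  - by move: srt; rewrite ltn_sorted_uniq_leq => /andP[].
  - by rewrite -srtE sort_sorted //; apply: leq_total.
  - apply: perm_trans (perm_seq_perm_eq _ sm) _.
    by rewrite perm_sym; apply: perm_seq_perm_eq.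
apply/permP => i; have := congr1 (fun u => nth 0 u i) eq_ss.
by rewrite !nth_perm_seq => /eqP; rewrite nth_uniq ?sm // => /eqP/val_inj.
Qed.

Lemma cart_nseqP N (J : seq nat) (m : seq nat) :
  reflect (size m = N /\ {subset m <= J}) (m \in cart (nseq N J)).
Proof.
apply: (iffP (cartP _ _)); rewrite size_nseq => -[sm Hm]; split=> //.
  move=> x /(nthP 0)[k]; rewrite sm => lt_k <-.
  by have := Hm k lt_k; rewrite nth_nseq lt_k.
by move=> k lt_k; rewrite nth_nseq lt_k Hm // mem_nth ?sm.
Qed.

Section StrictSums.

Local Open Scope ring_scope.
Variables (R : comNzRingType) (N : nat).

Lemma perm_cart_nseq (s : 'S_N) (J : seq nat) : uniq J ->
  perm_eq [seq perm_seq s m | m <- cart (nseq N J)] (cart (nseq N J)).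
Proof.
move=> uJ; have uL : uniq (cart (nseq N J)).
  by apply/cart_uniq/allP => K /nseqP[->].
have sL m : m \in cart (nseq N J) -> size m = N by case/cart_nseqP.
have stab (t : 'S_N) m : m \in cart (nseq N J) -> perm_seq t m \in cart (nseq N J).
  case/cart_nseqP=> sm Hm; apply/cart_nseqP; rewrite size_perm_seq; split=> // x.
  by rewrite (perm_mem (perm_seq_perm_eq _ sm)) => /Hm.
apply: uniq_perm => //.
  rewrite map_inj_in_uniq // => m1 m2 /sL s1 /sL s2 eq12.
  by rewrite -(perm_seqK s s1) eq12 perm_seqK.
move=> m; apply/mapP/idP => [[m' mL ->]|mL]; first exact: stab.
exists (perm_seq s^-1 m); first exact: stab.
by rewrite -[s in perm_seq s _]invgK perm_seqK // sL.
Qed.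

(* Every injective word is a permutation of exactly one increasing word, and
   the determinant in [f] changes by the sign of that permutation. *)
Lemma sum_strict_det_det (J : seq nat) (x : nat -> R) (f g : nat -> nat -> R) :
  uniq J ->
  \sum_(m <- cart (nseq N J) | sorted ltn m)
     (\prod_(v <- m) x v) * \det (\matrix_(k < N, j < N) f k (nth 0%N m j)) *
     \det (\matrix_(j < N, k < N) g k (nth 0%N m j)) =
  \sum_(m <- cart (nseq N J))
     (\prod_(v <- m) x v) * \det (\matrix_(k < N, j < N) f k (nth 0%N m j)) *
     \prod_(j < N) g j (nth 0%N m j).
Proof.
move=> uJ; set L := cart _.
pose Phi m := (\prod_(v <- m) x v) * \det (\matrix_(k < N, j < N) f k (nth 0%N m j)).
pose H m := Phi m * \prod_(j < N) g j (nth 0%N m j).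
have sL m : m \in L -> size m = N by case/cart_nseqP.
have PhiS (s : 'S_N) m : size m = N -> Phi (perm_seq s m) = (-1) ^+ s * Phi m.
  move=> sm; rewrite /Phi (perm_big _ (perm_seq_perm_eq s sm)) mulrCA; congr (_ * _).
  rewrite -odd_permV -det_perm mulrC -det_mulmx -col_permE; congr (\det _).
  by apply/matrixP => k j; rewrite !mxE nth_perm_seq.
(* Words with a repeated letter contribute 0 to the right-hand side, since two columns of the [f]
   determinant coincide. *)
transitivity (\sum_(m <- L | uniq m) H m); last first.
  rewrite [RHS](bigID uniq) /= [X in _ + X]big1_seq ?addr0 // => m /andP[Num /sL sm].
  rewrite /H /Phi.
  have [i [j [lt_ij eq_ij]]] : exists i j : 'I_N, i != j /\ nth 0%N m i = nth 0%N m j.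
    have /(uniqPn 0%N)[i [j [lt_ij lt_j eq_ij]]] := Num.
    rewrite sm in lt_j; exists (Ordinal (ltn_trans lt_ij lt_j)), (Ordinal lt_j).
    by split=> //; rewrite -val_eqE /= neq_ltn lt_ij.
  rewrite -det_tr (determinant_alternate lt_ij) ?mulr0 ?mul0r // => k.
  by rewrite !mxE eq_ij.
(* Exactly one [s] sorts an injective word, so the inner sum is one copy of [H m]. *)
transitivity (\sum_(m <- L | uniq m)
    \sum_(s : 'S_N | sorted ltn (perm_seq s m)) H m); last first.
  rewrite big_seq_cond [RHS]big_seq_cond; apply: eq_bigr => m /andP[/sL sm um].
  by have [s0 s0E] := perm_seq_sort sm um; rewrite (big_pred1 s0).
rewrite (exchange_big_dep predT) //=.
(* For fixed [s], rearranging letters permutes the set of all words; the sorted word becomes the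
   summation variable. *)
transitivity (\sum_(s : 'S_N) \sum_(m <- L | sorted ltn m) H (perm_seq s^-1 m)); last first.
  apply: eq_bigr => s _; rewrite -(perm_big _ (perm_cart_nseq s uJ)) big_map /=.
  rewrite big_seq_cond [RHS]big_seq_cond; apply: eq_big => [m|m /andP[/sL sm _]].
    case mL: (m \in L) => //=; have sm := sL m mL.
    rewrite -(perm_uniq (perm_seq_perm_eq s sm)).
    by case srt: sorted => //=; rewrite ?andbF // (sorted_uniq ltn_trans ltnn).
  by rewrite perm_seqK.
(* For increasing [m], the signed diagonal products of its rearrangements form the Leibniz expansion
   of the [g] determinant. *)
rewrite exchange_big /=; rewrite big_seq_cond [RHS]big_seq_cond.
apply: eq_bigr => m /andP[/sL sm _].
rewrite -/(Phi m) /determinant mulr_sumr.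
apply: eq_bigr => s _; rewrite /H PhiS // odd_permV mulrCA -!mulrA; congr (_ * _).
congr (_ * (_ * _)); rewrite [RHS](reindex_inj (@perm_inj _ s)).
by apply: eq_bigr => j _; rewrite mxE nth_perm_seq permK.
Qed.

End StrictSums.

(** * Tableaux and Frobenius coordinates *)

Lemma SSYTP (la : seq nat) (T : seq (seq nat)) :
  reflect [/\ size T = size la,
              forall i, i < size la -> size (nth [::] T i) = nth 0 la i,
              forall i j, j < nth 0 la i -> 0 < entry T i j,
              forall i j, j.+1 < nth 0 la i -> entry T i j <= entry T i j.+1 &
              forall i j, j < nth 0 la i.+1 -> entry T i j < entry T i.+1 j]
          (is_SSYT la T).
Proof.
(* Beyond the last row [nth 0 la i] is 0, so [j < nth 0 la i] forces [i] to be a row index. *)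
have lt_size i j : j < nth 0 la i -> i < size la.
  by case: (ltnP i (size la)) => // le_i; rewrite nth_default.
apply: (iffP and5P) => -[H1 H2 H3 H4 H5]; split.
- exact/eqP.
- by move=> i lt_i; apply/eqP/(allP H2); rewrite mem_iota.
- move=> i j lt_j; have lt_i := lt_size i j lt_j.
  by apply: (allP (allP H3 i _)); rewrite mem_iota.
- move=> i j lt_j; have lt_i := lt_size i _ lt_j.
  by apply: (allP (allP H4 i _)); rewrite mem_iota //; lia.
- move=> i j lt_j; have lt_i := lt_size _ _ lt_j.
  by apply: (allP (allP H5 i _)); rewrite mem_iota //; lia.
- exact/eqP.
- by apply/allP => i; rewrite mem_iota => lt_i; apply/eqP/H2.
- apply/allP => i; rewrite mem_iota => lt_i; apply/allP => j; rewrite mem_iota.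
  exact: H3.
- apply/allP => i; rewrite mem_iota => lt_i; apply/allP => j; rewrite mem_iota => lt_j.
  by apply: H4; lia.
- apply/allP => i; rewrite mem_iota => lt_i; apply/allP => j; rewrite mem_iota.
  exact: H5.
Qed.

Definition frob_ps (la : seq nat) : seq nat := [seq frob_p la k | k <- iota 0 (frobN la)].
Definition frob_qs (la : seq nat) : seq nat := [seq frob_q la k | k <- iota 0 (frobN la)].

Section Frobenius.

Variable la : seq nat.
Hypothesis la_part : is_partition la.

Lemma part_noninc i j : i <= j -> nth 0 la j <= nth 0 la i.
Proof.
case/andP: la_part => srt _ le_ij.
case: (ltnP j (size la)) => [lt_j|le_j]; last by rewrite (nth_default _ le_j).
have geq_tr : transitive geq by move=> y x z /= xy yz; apply: leq_trans yz xy.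
by apply: (sorted_leq_nth geq_tr leqnn 0 srt) => //; rewrite inE; lia.
Qed.

Lemma part_lt_size i j : j < nth 0 la i -> i < size la.
Proof. by case: (ltnP i (size la)) => // le_i; rewrite nth_default. Qed.

(** A downward closed predicate holds exactly on an initial segment, whose length is its count. This
    serves both the main diagonal and the columns. *)
Lemma ltn_count_part (b : pred nat) k (s : nat) :
  (forall i j, i <= j -> b j -> b i) -> (b k -> k < s) ->
  (k < count b (iota 0 s)) = b k.
Proof.
move=> b_mono; elim: s => [|s IH] b_s; first by case: (b k) b_s => // ->.
rewrite -[X in iota 0 X]addn1 iotaD count_cat /= addn0 add0n.
case bs: (b s); last first.
  rewrite addn0 IH // => bk; have := b_s bk; rewrite ltnS leq_eqVlt => /predU1P[ks|//].
  by rewrite -ks bk in bs.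
have -> : count b (iota 0 s) = s.
  apply/eqP; rewrite -[X in _ == X](size_iota 0 s) -all_count; apply/allP => i.
  by rewrite mem_iota => /andP[_ lt_i]; apply: b_mono bs; apply: ltnW.
rewrite addn1; apply/idP/idP => [|/b_s //]; rewrite ltnS => le_ks; exact: b_mono bs.
Qed.

Lemma ltn_frobN k : (k < frobN la) = (k < nth 0 la k).
Proof.
apply: ltn_count_part => [i j le_ij lt_j|]; last exact: part_lt_size.
exact: leq_ltn_trans le_ij (leq_trans lt_j (part_noninc le_ij)).
Qed.

Lemma ltn_conj_part k c : (k < conj_part la c) = (c < nth 0 la k).
Proof.
have -> : conj_part la c = count (fun i => c < nth 0 la i) (iota 0 (size la)).
  by rewrite /conj_part -{1}(mkseq_nth 0 la) /mkseq count_map.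
apply: (@ltn_count_part (fun i => c < nth 0 la i)) => [i j le_ij lt_j|].
  exact: leq_trans lt_j (part_noninc le_ij).
exact: part_lt_size.
Qed.

Lemma frob_ps_sorted : sorted gtn (frob_ps la).
Proof.
apply/(sortedP 0) => k; rewrite size_map size_iota => lt_k.
rewrite !(nth_map 0) ?size_iota ?nth_iota // ?(ltnW lt_k) //= !add0n /frob_p.
by move: lt_k; rewrite ltn_frobN; move: (part_noninc (leqnSn k)); lia.
Qed.

Lemma frob_qs_sorted : sorted gtn (frob_qs la).
Proof.
apply/(sortedP 0) => k; rewrite size_map size_iota => lt_k.
rewrite !(nth_map 0) ?size_iota ?nth_iota // ?(ltnW lt_k) //= !add0n /frob_q.
have le_k : conj_part la k.+1 <= conj_part la k by apply: sub_count => x /=; lia.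
by move: lt_k le_k; rewrite ltn_frobN -ltn_conj_part; lia.
Qed.

(** The right-hand side says that box [(k, k + c)], counted from 0, lies in the diagram. So the rank
    is the number of boxes of content [c]. *)
Lemma ltn_rank_ps c k : (k < rank (frob_ps la) c) = (k + c < nth 0 la k).
Proof.
rewrite ltn_rank ?frob_ps_sorted // size_map size_iota.
case: (ltnP k (frobN la)) => [lt_k|le_k] /=.
  rewrite (nth_map 0) ?size_iota ?nth_iota // add0n /frob_p.
  by move: lt_k; rewrite ltn_frobN; lia.
by move: le_k; rewrite leqNgt ltn_frobN; lia.
Qed.

(** The mirror image below the diagonal: the boxes [(k + c, k)], of content [- c]. *)
Lemma ltn_rank_qs c k : (k < rank (frob_qs la) c) = (k < nth 0 la (k + c)).
Proof.
rewrite ltn_rank ?frob_qs_sorted // size_map size_iota -ltn_conj_part.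
case: (ltnP k (frobN la)) => [lt_k|le_k] /=.
  rewrite (nth_map 0) ?size_iota ?nth_iota // add0n /frob_q.
  by move: lt_k; rewrite ltn_frobN -ltn_conj_part; lia.
by move: le_k; rewrite leqNgt ltn_frobN -ltn_conj_part; lia.
Qed.

Lemma rank_ps0 : rank (frob_ps la) 0 = frobN la.
Proof. by rewrite /rank (eq_count (a2 := predT)) // count_predT size_map size_iota. Qed.

Lemma rank_qs0 : rank (frob_qs la) 0 = frobN la.
Proof. by rewrite /rank (eq_count (a2 := predT)) // count_predT size_map size_iota. Qed.

Lemma frob_ps_lt : all (gtn (nth 0 la 0)) (frob_ps la).
Proof.
apply/allP => _ /mapP[k + ->]; rewrite mem_iota /= add0n ltn_frobN /frob_p.
by move: (part_noninc (leq0n k)); lia.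
Qed.

Lemma frob_qs_lt : all (gtn (size la)) (frob_qs la).
Proof.
apply/allP => _ /mapP[k + ->]; rewrite mem_iota /= add0n ltn_frobN /frob_q.
rewrite -ltn_conj_part; move: (count_size (fun x => k < x) la); rewrite -/(conj_part la k).
by lia.
Qed.

Definition diag_cells : seq (nat * nat) :=
  [seq (k, k) | k <- iota 0 (frobN la)] ++
  [seq (k, k + t.+1) | t <- iota 0 (nth 0 la 0), k <- iota 0 (rank (frob_ps la) t.+1)] ++
  [seq (k + t.+1, k) | t <- iota 0 (size la), k <- iota 0 (rank (frob_qs la) t.+1)].

Lemma perm_diag_cells :
  perm_eq [seq (i, j) | i <- iota 0 (size la), j <- iota 0 (nth 0 la i)] diag_cells.
Proof.
have mem_up i j : ((i, j) \in [seq (k, k + t.+1) | t <- iota 0 (nth 0 la 0),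
    k <- iota 0 (rank (frob_ps la) t.+1)]) = (i < j < nth 0 la i).
  apply/allpairsPdep/idP => [[t [k []]]|/andP[lt_ij lt_j]].
    by rewrite !mem_iota !add0n ltn_rank_ps => _ lt_k [-> ->]; lia.
  have le0 := part_noninc (leq0n i).
  exists (j - i).-1, i; rewrite !mem_iota !add0n ltn_rank_ps; split; [lia|lia|].
  by congr pair; lia.
have mem_lo i j : ((i, j) \in [seq (k + t.+1, k) | t <- iota 0 (size la),
    k <- iota 0 (rank (frob_qs la) t.+1)]) = (j < i) && (j < nth 0 la i).
  apply/allpairsPdep/idP => [[t [k []]]|/andP[lt_ji lt_j]].
    by rewrite !mem_iota !add0n ltn_rank_qs => _ lt_k [-> ->]; lia.
  have lt_i := part_lt_size lt_j.
  exists (i - j).-1, j; rewrite !mem_iota !add0n ltn_rank_qs.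
  have -> : j + (i - j).-1.+1 = i by lia.
  by split=> //; lia.
have mem_di i j : ((i, j) \in [seq (k, k) | k <- iota 0 (frobN la)]) =
    (i == j) && (j < nth 0 la i).
  apply/mapP/idP => [[k + [-> ->]]|/andP[/eqP -> lt_j]].
    by rewrite mem_iota add0n ltn_frobN eqxx.
  by exists j; rewrite ?mem_iota ?add0n ?ltn_frobN.
apply: uniq_perm.
- apply: allpairs_uniq_dep; first exact: iota_uniq.
    by move=> i _; apply: iota_uniq.
  by move=> [i j] [i' j'] _ _ /= [-> ->].
- rewrite !cat_uniq map_inj_uniq ?iota_uniq => [/=|k k' [] //].
  apply/and3P; split.
  + apply/hasPn => -[i j]; rewrite mem_cat mem_up mem_lo mem_di; lia.
  + apply: allpairs_uniq_dep => [|t _|]; [exact: iota_uniq|exact: iota_uniq|].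
    by move=> [t k] [t' k'] _ _ /= [-> E]; congr existT; lia.
  apply/andP; split.
    by apply/hasPn => -[i j]; rewrite mem_up mem_lo; lia.
  apply: allpairs_uniq_dep => [|t _|]; [exact: iota_uniq|exact: iota_uniq|].
  by move=> [t k] [t' k'] _ _ /= [E kk]; subst k'; congr existT; lia.
move=> [i j]; rewrite !mem_cat mem_up mem_lo mem_di.
apply/allpairsPdep/idP => [[i' [j' []]]|H].
  by rewrite !mem_iota !add0n => _ lt_j [-> ->]; lia.
exists i, j; rewrite !mem_iota !add0n; split=> //; last by lia.
by apply: (@part_lt_size i j); lia.
Qed.

End Frobenius.

(** With [m] put in front as diagonal 0, membership becomes inequalities between neighbouring
    diagonals. The bound [n] is explicit only for an entry with no right neighbour on the preceding
    diagonal. *)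
Lemma slices_entriesP d n r P m D :
  size m = r 0 ->
  reflect [/\ size D = P, forall t, t < P -> size (nth [::] D t) = r t.+1 &
    forall t k, t < P -> k < r t.+1 ->
      [/\ nth 0 (nth [::] (m :: D) t) k + d <= nth 0 (nth [::] D t) k,
          k.+1 < r t -> nth 0 (nth [::] D t) k < nth 0 (nth [::] (m :: D) t) k.+1 + d &
          r t <= k.+1 -> nth 0 (nth [::] D t) k <= n]]
    (D \in slices d n r P 0 m).
Proof.
move=> sm; apply: (iffP (slicesP _ _ _ _ _ _ _)) => [[sD HD]|[sD rD HD]].
  have rD t : t < P -> size (nth [::] D t) = r t.+1.
    by move=> /HD/cart_gapsP[].
  have sE t : t < P -> size (nth [::] (m :: D) t) = r t.
    by case: t => [|t] //= lt_t; apply: rD; apply: ltnW.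
  split=> // t k lt_t lt_k; have /cart_gapsP[_ /(_ k lt_k)] := HD t lt_t.
  rewrite sE // => /andP[le_k lt_k']; split=> // [lt_k1|le_k1].
    by move: lt_k'; rewrite lt_k1.
  by move: lt_k'; rewrite (ltnNge k.+1) le_k1.
split=> // t lt_t; apply/cart_gapsP; split=> [|k lt_k]; first exact: rD.
have sE : size (nth [::] (m :: D) t) = r t.
  by case: t lt_t {lt_k} => [|t] //= lt_t; apply: rD; apply: ltnW.
have [-> H1 H2] := HD t k lt_t lt_k; rewrite sE /=.
by case: (ltnP k.+1 (r t)) => [/H1|/H2].
Qed.

(** * Bijection between bounded tableaux and families of interlacing diagonals *)

Section Tableaux.

Variable la : seq nat.
Hypothesis la_part : is_partition la.

Let rp := rank (frob_ps la).
Let rq := rank (frob_qs la).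
Let rpE c k : (k < rp c) = (k + c < nth 0 la k) := ltn_rank_ps la_part c k.
Let rqE c k : (k < rq c) = (k < nth 0 la (k + c)) := ltn_rank_qs la_part c k.

(** Box [(i, j)] is the entry number [min i j] of the diagonal at distance [|j - i|]. *)
Definition diag_entry (m : seq nat) (D E : seq (seq nat)) (i j : nat) : nat :=
  if i <= j then nth 0 (nth [::] (m :: D) (j - i)) i
  else nth 0 (nth [::] (m :: E) (i - j)) j.

Definition diag_tab (x : seq nat * (seq (seq nat) * seq (seq nat))) : seq (seq nat) :=
  mkseq (fun i => mkseq (diag_entry x.1 x.2.1 x.2.2 i) (nth 0 la i)) (size la).

Lemma entry_diag_tab m D E i j : j < nth 0 la i ->
  entry (diag_tab (m, (D, E))) i j = diag_entry m D E i j.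
Proof.
by move=> lt_j; rewrite /entry !nth_mkseq //; apply: part_lt_size lt_j.
Qed.

Definition diag_data (n : nat) : seq (seq nat * (seq (seq nat) * seq (seq nat))) :=
  [seq (m, DE) |
     m <- [seq m <- cart (nseq (frobN la) (index_iota 1 n.+1)) | sorted ltn m],
     DE <- [seq (D, E) | D <- slices 0 n rp (nth 0 la 0) 0 m,
                         E <- slices 1 n rq (size la) 0 m]].

Lemma diag_dataP n m D E :
  reflect [/\ (m \in cart (nseq (frobN la) (index_iota 1 n.+1))) && sorted ltn m,
              D \in slices 0 n rp (nth 0 la 0) 0 m & E \in slices 1 n rq (size la) 0 m]
          ((m, (D, E)) \in diag_data n).
Proof.
apply: (iffP allpairsPdep) => [[m' [DE []]]|[mP DP EP]].
  rewrite mem_filter andbC => mP /allpairsPdep[D' [E' [DP EP ->]]] [-> -> ->].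
  by [].
exists m, (D, E); rewrite mem_filter andbC; split=> //.
by apply/allpairsPdep; exists D, E.
Qed.

Lemma diag_data_uniq n : uniq (diag_data n).
Proof.
apply: allpairs_uniq_dep => [|m _|].
- by apply/filter_uniq/cart_uniq/allP => K /nseqP[-> _]; apply: iota_uniq.
- apply: allpairs_uniq_dep; first exact: slices_uniq.
    by move=> D _; apply: slices_uniq.
  by move=> [D E] [D' E'] _ _ /= [-> ->].
by move=> [m DE] [m' DE'] _ _ /= [-> ->].
Qed.

Lemma diag_sizes n m D E : (m, (D, E)) \in diag_data n ->
  [/\ size m = frobN la, size D = nth 0 la 0, size E = size la,
      forall t, t < nth 0 la 0 -> size (nth [::] D t) = rp t.+1 &
      forall t, t < size la -> size (nth [::] E t) = rq t.+1].
Proof.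
case/diag_dataP=> /andP[/cart_nseqP[sm _] _].
move=> /slices_entriesP[]; rewrite ?sm /rp ?rank_ps0 // => sD rD _.
by move=> /slices_entriesP[]; rewrite ?sm /rq ?rank_qs0.
Qed.

(** [la] fixes all lengths and every position of a diagonal is a box of the diagram, so the tableau
    determines all the lists. *)
Lemma diag_tab_inj n : {in diag_data n &, injective diag_tab}.
Proof.
move=> [m [D E]] [m' [D' E']] /diag_sizes[sm sD sE rD rE] /diag_sizes[sm' sD' sE' rD' rE'].
move=> eqT; have eqE i j : j < nth 0 la i -> diag_entry m D E i j = diag_entry m' D' E' i j.
  by move=> lt_j; rewrite -!entry_diag_tab // eqT.
congr (_, (_, _)).
- apply: (@eq_from_nth _ 0) => [|k]; rewrite sm ?sm' // ltn_frobN // => lt_k.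
  by have := eqE k k lt_k; rewrite /diag_entry leqnn subnn.
- apply: (@eq_from_nth _ [::]) => [|t]; rewrite sD ?sD' // => lt_t.
  apply: (@eq_from_nth _ 0) => [|k]; rewrite rD ?rD' // rpE => lt_k.
  by have := eqE k (k + t.+1) lt_k; rewrite /diag_entry leq_addr addKn.
apply: (@eq_from_nth _ [::]) => [|t]; rewrite sE ?sE' // => lt_t.
apply: (@eq_from_nth _ 0) => [|k]; rewrite rE ?rE' // rqE => lt_k.
have := eqE (k + t.+1) k lt_k; rewrite /diag_entry addKn.
by have -> : (k + t.+1 <= k) = false by lia.
Qed.

(** Above the main diagonal the lower interlacing bound is a row condition and the upper one a
    column condition. Below it the roles are exchanged, and the shift 1 moves strictness from the
    upper bound to the lower one. *)
Lemma diag_tab_SSYT n x : x \in diag_data n ->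
  is_SSYT la (diag_tab x) /\
  forall i j, j < nth 0 la i -> entry (diag_tab x) i j <= n.
Proof.
case: x => m [D E] /diag_dataP[/andP[/cart_nseqP[sm Hm] srt]].
have sm_p : size m = rp 0 by rewrite sm /rp rank_ps0.
have sm_q : size m = rq 0 by rewrite sm /rq rank_qs0.
move=> /(slices_entriesP _ _ _ _ sm_p)[sD rD HD] /(slices_entriesP _ _ _ _ sm_q)[sE rE HE].
have m_bnd k : k < frobN la -> 1 <= nth 0 m k <= n.
  by move=> lt_k; have := Hm (nth 0 m k) (mem_nth _ _); rewrite sm mem_index_iota; apply.
(* An entry inherits positivity from its predecessor on the previous diagonal. It is at most [n]
   either explicitly or through the next entry of that diagonal, hence the induction on [t]. *)
have bndU t k : k + t < nth 0 la k -> 1 <= nth 0 (nth [::] (m :: D) t) k <= n.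
  elim: t k => [|t IH] k lt_k /=; first by apply: m_bnd; rewrite ltn_frobN //; lia.
  have lt_t : t < nth 0 la 0 by have := part_noninc la_part (leq0n k); lia.
  have [|h1 h2 h3] := HD t k lt_t; first by rewrite rpE.
  have /andP[IH1 _] := IH k (ltac:(lia)).
  have -> /= : 0 < nth 0 (nth [::] D t) k by apply: leq_trans h1; rewrite addn0.
  case: (ltnP k.+1 (rp t)) => [lt_k1|/h3 //].
  move: (h2 lt_k1); rewrite addn0 => /ltnW h; apply: leq_trans h _.
  by move: lt_k1; rewrite rpE => /IH/andP[].
have bndL t k : k < nth 0 la (k + t) -> 1 <= nth 0 (nth [::] (m :: E) t) k <= n.
  elim: t k => [|t IH] k lt_k /=; first
    by apply: m_bnd; rewrite ltn_frobN //; move: lt_k; rewrite addn0.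
  have lt_t : t < size la by have := part_lt_size lt_k; lia.
  have [|h1 h2 h3] := HE t k lt_t; first by rewrite rqE.
  have lt_k' : k < nth 0 la (k + t).
    by apply: leq_trans lt_k _; apply: part_noninc => //; lia.
  have /andP[IH1 _] := IH k lt_k'.
  have -> /= : 0 < nth 0 (nth [::] E t) k by apply: leq_trans h1; rewrite addn1.
  case: (ltnP k.+1 (rq t)) => [lt_k1|/h3 //].
  move: (h2 lt_k1); rewrite addn1 ltnS => h; apply: leq_trans h _.
  by move: lt_k1; rewrite rqE => /IH/andP[].
have bnd i j : j < nth 0 la i -> 1 <= diag_entry m D E i j <= n.
  rewrite /diag_entry; case: (leqP i j) => [le_ij|lt_ji] lt_j.
    by apply: bndU; rewrite subnKC.
  by apply: bndL; rewrite subnKC // ltnW.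
split; last by move=> i j lt_j; rewrite entry_diag_tab //; case/andP: (bnd i j lt_j).
apply/SSYTP; split.
- by rewrite size_mkseq.
- by move=> i lt_i; rewrite nth_mkseq // size_mkseq.
- by move=> i j lt_j; rewrite entry_diag_tab //; case/andP: (bnd i j lt_j).
- move=> i j lt_j; rewrite !entry_diag_tab ?(ltnW lt_j) // /diag_entry.
  have lt_i := part_lt_size lt_j; have le0 := part_noninc la_part (leq0n i).
  case: (leqP i j) => [le_ij|lt_ji].
    have [||h1 _ _] := HD (j - i) i; [lia|by rewrite rpE; lia|].
    by rewrite leqW // subSn //; move: h1; rewrite addn0.
  (* Moving right from below the main diagonal approaches it, so the neighbour is on diagonal [t],
     which is the main one when [t = 0]. *)
  have [t it] : exists t, i = j + t.+1 by exists (i - j).-1; lia.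
  subst i; have [||_ h2 _] := HE t j; [lia|by rewrite rqE ltnW|].
  move: h2; rewrite addKn rqE addn1 ltnS addSnnS => /(_ lt_j).
  case: t {lt_i lt_j lt_ji le0} => [|t]; first by rewrite addn1 leqnn subnn.
  have -> : (j + t.+2 <= j.+1) = false by lia.
  by have -> : j + t.+2 - j.+1 = t.+1 by lia.
move=> i j lt_j; have lt_i := part_lt_size lt_j.
have lt_j' : j < nth 0 la i by apply: leq_trans lt_j _; apply: part_noninc.
have le0 := part_noninc la_part (leq0n i).
rewrite !entry_diag_tab // /diag_entry.
case: (leqP i j) => [le_ij|lt_ji]; last first.
  have [||h1 _ _] := HE (i - j) j; [lia|rewrite rqE|].
    by rewrite addnS subnKC // ltnW.
  have -> : (i.+1 <= j) = false by lia.
  by move: h1; rewrite addn1 subSn // ltnW.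
case: (leqP i.+1 j) => [lt_ij|le_ji]; last first.
  have ji : j = i by lia.
  subst j; have [||h1 _ _] := HE 0 i; [lia|by rewrite rqE addn1|].
  by move: h1; rewrite subnn subSnn /= addn1.
have [||_ h2 _] := HD (j - i.+1) i; [lia|by rewrite rpE; lia|].
have -> : j - i = (j - i.+1).+1 by lia.
move: h2; rewrite addn0 rpE; apply; lia.
Qed.

Lemma SSYT_diag_tab n T : is_SSYT la T ->
  (forall i j, j < nth 0 la i -> entry T i j <= n) -> T \in map diag_tab (diag_data n).
Proof.
move=> /SSYTP[sT rT pos row col] le_n.
pose m := mkseq (fun k => entry T k k) (frobN la).
pose D := mkseq (fun t => mkseq (fun k => entry T k (k + t.+1)) (rp t.+1)) (nth 0 la 0).
pose E := mkseq (fun t => mkseq (fun k => entry T (k + t.+1) k) (rq t.+1)) (size la).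
have mE k : k < frobN la -> nth 0 m k = entry T k k by move=> lt_k; rewrite nth_mkseq.
have UE t k : k + t < nth 0 la k -> nth 0 (nth [::] (m :: D) t) k = entry T k (k + t).
  move=> lt_k; have le0 := part_noninc la_part (leq0n k).
  case: t lt_k => [|t] lt_k /=; first by rewrite addn0 in lt_k *; rewrite mE // ltn_frobN.
  by rewrite !nth_mkseq ?rpE //; lia.
have LE t k : k < nth 0 la (k + t) -> nth 0 (nth [::] (m :: E) t) k = entry T (k + t) k.
  move=> lt_k; have lt_s := part_lt_size lt_k.
  case: t lt_k lt_s => [|t] lt_k lt_s /=.
    by rewrite addn0 in lt_k *; rewrite mE // ltn_frobN.
  by rewrite !nth_mkseq ?rqE //; lia.
apply/mapP; exists (m, (D, E)).
  have sm : size m = frobN la by rewrite size_mkseq.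
  have sm_p : size m = rp 0 by rewrite sm /rp rank_ps0.
  have sm_q : size m = rq 0 by rewrite sm /rq rank_qs0.
  apply/diag_dataP; split.
  - apply/andP; split.
      apply/cart_nseqP; split=> // _ /(nthP 0)[k + <-]; rewrite sm => lt_k.
      rewrite mE // mem_index_iota ltnS; move: lt_k; rewrite ltn_frobN // => lt_k.
      by rewrite pos ?le_n.
    apply/(sortedP 0) => k; rewrite sm => lt_k; rewrite !mE //; last exact: ltnW.
    move: lt_k; rewrite ltn_frobN // => lt_k.
    have := part_noninc la_part (leqnSn k) => le_k.
    (* A weak step right followed by a strict step down makes the main diagonal strictly
       increasing. *)
    by apply: leq_ltn_trans (row k k _) (col k k.+1 lt_k); lia.
  - apply/slices_entriesP => //; split; first by rewrite size_mkseq.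
      by move=> t lt_t; rewrite nth_mkseq // size_mkseq.
    move=> t k lt_t; rewrite rpE => lt_k.
    have -> : nth 0 (nth [::] D t) k = entry T k (k + t.+1) by rewrite -(UE t.+1).
    split.
    + rewrite UE ?addn0; last by lia.
      by rewrite addnS; apply: row; rewrite -addnS.
    + by rewrite rpE => lt_k1; rewrite UE // addn0 addSnnS; apply: col; lia.
    + by move=> _; apply: le_n.
  apply/slices_entriesP => //; split; first by rewrite size_mkseq.
    by move=> t lt_t; rewrite nth_mkseq // size_mkseq.
  move=> t k lt_t; rewrite rqE => lt_k.
  have -> : nth 0 (nth [::] E t) k = entry T (k + t.+1) k by rewrite -(LE t.+1).
  split.
  + rewrite LE ?addn1.
      by rewrite addnS; apply: col; rewrite -addnS.
    by apply: leq_trans lt_k _; apply: part_noninc => //; lia.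
  + rewrite rqE => lt_k1; rewrite LE // addn1 ltnS addSnnS; apply: row.
    by rewrite -addSnnS.
  + by move=> _; apply: le_n.
apply: (@eq_from_nth _ [::]) => [|i]; rewrite sT ?size_mkseq // => lt_i.
rewrite nth_mkseq //; apply: (@eq_from_nth _ 0) => [|j]; rewrite rT ?size_mkseq // => lt_j.
rewrite nth_mkseq // /diag_entry; case: (leqP i j) => [le_ij|lt_ji] /=.
  by rewrite UE subnKC.
by rewrite LE subnKC // ltnW.
Qed.

Lemma mem_diag_tabs n T :
  reflect (is_SSYT la T /\ forall i j, j < nth 0 la i -> entry T i j <= n)
          (T \in map diag_tab (diag_data n)).
Proof.
apply: (iffP idP) => [/mapP[x /diag_tab_SSYT[H1 H2] ->]|[H1 H2]]; first by split.
exact: SSYT_diag_tab.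
Qed.

End Tableaux.

(** * Weighted sums over bounded tableaux *)

Section TableauSums.

Local Open Scope ring_scope.
Variables (A : comNzRingType) (W : Z -> nat -> A) (n : nat) (la : seq nat).
Hypothesis la_part : is_partition la.

Let Wp c v := W (Z.of_nat c) v.
Let Wq c v := W (Z.opp (Z.of_nat c)) v.

Lemma prod_nth (s : seq nat) (g : nat -> A) :
  \prod_(v <- s) g v = \prod_(k <- iota 0 (size s)) g (nth 0%N s k).
Proof. by rewrite (big_nth 0%N) /index_iota subn0. Qed.

Lemma slices_weightE (X : nat -> nat -> A) c D :
  slices_weight X c D =
  \prod_(t <- iota 0 (size D)) \prod_(v <- nth [::] D t) X (c + t).+1 v.
Proof.
elim: D c => [|a D IH] c /=; first by rewrite big_nil.
rewrite big_cons addn0 IH; congr (_ * _).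
rewrite -[1%N]addn0 iotaDl big_map; apply: eq_bigr => t _.
by rewrite add1n addSnnS.
Qed.

(** The weight [W] is arbitrary, so the same identity can be applied to the zeta summands and to
    their absolute values. *)
Definition tab_weight (T : seq (seq nat)) : A :=
  \prod_(i <- iota 0 (size la)) \prod_(j <- iota 0 (nth 0%N la i))
     W (content i j) (entry T i j).

Lemma tab_weight_diag m D E : (m, (D, E)) \in diag_data la n ->
  tab_weight (diag_tab la (m, (D, E))) =
  (\prod_(v <- m) W Z0 v) * (slices_weight Wp 0 D * slices_weight Wq 0 E).
Proof.
case/diag_sizes => sm sD sE rD rE.
pose cw (x : nat * nat) := W (content x.1 x.2) (diag_entry m D E x.1 x.2).
transitivity (\prod_(x <- [seq (i, j) | i <- iota 0 (size la), j <- iota 0 (nth 0%N la i)]) cw x).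
  rewrite big_allpairs_dep /tab_weight big_seq [RHS]big_seq; apply: eq_bigr => i _.
  rewrite big_seq [RHS]big_seq; apply: eq_bigr => j; rewrite mem_iota => /andP[_ lt_j].
  by rewrite entry_diag_tab.
rewrite (perm_big _ (perm_diag_cells la_part)) !big_cat /= big_map !big_allpairs_dep.
rewrite !slices_weightE sD sE (prod_nth m) sm; congr (_ * (_ * _)).
- apply: eq_bigr => k _; rewrite /cw /diag_entry /= leqnn subnn /=.
  by rewrite /content Z.sub_diag.
- rewrite big_seq [RHS]big_seq; apply: eq_bigr => t; rewrite mem_iota add0n => /andP[_ lt_t].
  rewrite (prod_nth (nth [::] D t)) rD //; apply: eq_bigr => k _.
  rewrite /cw /diag_entry /= leq_addr addKn /= /content /Wp; congr (W _ _).
  by lia.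
rewrite big_seq [RHS]big_seq; apply: eq_bigr => t; rewrite mem_iota add0n => /andP[_ lt_t].
rewrite (prod_nth (nth [::] E t)) rE //; apply: eq_bigr => k _.
rewrite /cw /diag_entry /= addKn /content /Wq.
have -> : (k + t.+1 <= k)%N = false by lia.
by congr (W _ _); lia.
Qed.

(** For a fixed main diagonal the upper and lower parts sum independently to determinants by
    [slices_det]; [sum_strict_det_det] then trades increasing words and two determinants for all
    words and one. *)
Lemma sum_tab_weight :
  \sum_(T <- map (diag_tab la) (diag_data la n)) tab_weight T =
  \sum_(m <- cart (nseq (frobN la) (index_iota 1 n.+1)))
    (\prod_(v <- m) W Z0 v) *
    \det (\matrix_(k < frobN la, j < frobN la)
            chain 0 n Wp (frob_p la k) 0 (nth 0%N m j)) *
    \prod_(j < frobN la) chain 1 n Wq (frob_q la j) 0 (nth 0%N m j).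
Proof.
rewrite big_map; transitivity (\sum_(x <- diag_data la n)
    (\prod_(v <- x.1) W Z0 v) * (slices_weight Wp 0 x.2.1 * slices_weight Wq 0 x.2.2)).
  rewrite big_seq [RHS]big_seq; apply: eq_bigr => -[m [D E]]; exact: tab_weight_diag.
rewrite big_allpairs_dep big_filter.
have /= <- := @sum_strict_det_det _ (frobN la) (index_iota 1 n.+1) (W Z0)
  (fun k v => chain 0 n Wp (frob_p la k) 0 v) (fun k v => chain 1 n Wq (frob_q la k) 0 v)
  (iota_uniq _ _).
rewrite big_seq_cond [RHS]big_seq_cond; apply: eq_bigr => m /andP[/cart_nseqP[sm Hm] srt].
rewrite big_allpairs_dep /=.
have le_m : all (geq n) m.
  by apply/allP => v /Hm; rewrite mem_index_iota ltnS => /andP[].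
have srt_m : sorted leq m by move: srt; rewrite ltn_sorted_uniq_leq => /andP[].
under eq_bigr => D _ do rewrite -mulr_sumr -mulr_sumr.
rewrite -mulr_sumr -mulrA -mulr_suml; congr (_ * (_ * _)).
- rewrite slices_det ?frob_ps_sorted ?frob_ps_lt ?rank_ps0 // -det_tr.
  congr (\det _); apply/matrixP => k j; rewrite !mxE subn0.
  by rewrite (nth_map 0%N) ?size_iota // nth_iota.
rewrite slices_det ?frob_qs_sorted ?frob_qs_lt ?rank_qs0 //.
congr (\det _); apply/matrixP => k j; rewrite !mxE subn0.
by rewrite (nth_map 0%N) ?size_iota // nth_iota.
Qed.

End TableauSums.

Lemma sum_cart_prod_ord (A : comNzRingType) N (J : seq nat) (h : 'I_N -> nat -> A) :
  (\sum_(m <- cart (nseq N J)) \prod_(j < N) h j (nth 0%N m j) =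
   \prod_(j < N) \sum_(v <- J) h j v)%R.
Proof.
pose h' j v := oapp (h^~ v) 0%R (insub j : option 'I_N).
have := sum_cart_prod (nseq N J) h'; rewrite size_nseq.
under eq_bigr do under eq_bigr do rewrite /h' valK /=.
move=> ->; apply: eq_bigr => j _; rewrite nth_nseq ltn_ord.
by apply: eq_bigr => v _; rewrite /h' valK.
Qed.

(** Reindexing by the inverse permutation makes factor [j] depend only on letter [j], so that the
    sum over words will factor. *)
Lemma det_prod_expand (A : comNzRingType) N (m : seq nat) (x : nat -> A)
    (f g : 'I_N -> nat -> A) : size m = N ->
  ((\prod_(v <- m) x v) * \det (\matrix_(k < N, j < N) f k (nth 0%N m j)) *
    \prod_(j < N) g j (nth 0%N m j) =
  \sum_(s : 'S_N) (-1) ^+ s * \prod_(j < N)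
    (x (nth 0%N m j) * f (s^-1 j)%g (nth 0%N m j) * g j (nth 0%N m j)))%R.
Proof.
move=> sm; rewrite /determinant mulr_sumr mulr_suml; apply: eq_bigr => s _.
rewrite mulrCA -mulrA; congr (_ * _)%R.
rewrite (big_nth 0%N) sm big_mkord !big_split /=; congr (_ * _ * _)%R.
rewrite (reindex_inj (@perm_inj _ s^-1%g)) /=.
by apply: eq_bigr => j _; rewrite mxE permKV.
Qed.

Lemma sum_cart_det_prod (A : comNzRingType) N (J : seq nat) (x : nat -> A)
    (f g : 'I_N -> nat -> A) :
  (\sum_(m <- cart (nseq N J))
    (\prod_(v <- m) x v) * \det (\matrix_(k < N, j < N) f k (nth 0%N m j)) *
    \prod_(j < N) g j (nth 0%N m j) =
  \sum_(s : 'S_N) (-1) ^+ s *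
    \prod_(j < N) \sum_(v <- J) x v * f (s^-1 j)%g v * g j v)%R.
Proof.
transitivity (\sum_(m <- cart (nseq N J)) \sum_(s : 'S_N) (-1) ^+ s *
    \prod_(j < N) (x (nth 0%N m j) * f (s^-1 j)%g (nth 0%N m j) * g j (nth 0%N m j)))%R.
  rewrite big_seq [RHS]big_seq; apply: eq_bigr => m /cart_nseqP[sm _].
  exact: det_prod_expand.
rewrite exchange_big /=; apply: eq_bigr => s _.
by rewrite -mulr_sumr (sum_cart_prod_ord _ (fun j v => x v * f (s^-1 j)%g v * g j v)%R).
Qed.

(** * Complex limits and unconditional sums *)

Local Open Scope R_scope.

HB.instance Definition _ := gen_eqMixin C.
(** The ring structure on [C] makes the determinant identities available for complex weights. *)
HB.instance Definition _ := gen_choiceMixin C.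
HB.instance Definition _ :=
  GRing.isZmodule.Build C Cplus_assoc Cplus_comm Cplus_0_l
    (fun z => etrans (Cplus_comm (Copp z) z) (Cplus_opp_r z)).
HB.instance Definition _ :=
  GRing.Zmodule_isComNzRing.Build C Cmult_assoc Cmult_comm Cmult_1_l
    Cmult_plus_distr_r (introN eqP C1_nz).

HB.instance Definition _ := Monoid.isComLaw.Build R (IZR 0) Rplus
  (fun x y z => esym (Rplus_assoc x y z)) Rplus_comm Rplus_0_l.

Lemma csum_bigE (X : Type) (F : seq X) (f : X -> C) :
  csum F f = (\sum_(x <- F) f x)%R.
Proof. by elim: F => [|x F IH]; rewrite ?big_nil ?big_cons //= IH. Qed.

Lemma cprod_bigE (X : Type) (F : seq X) (f : X -> C) :
  Defs.cprod F f = (\prod_(x <- F) f x)%R.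
Proof. by elim: F => [|x F IH]; rewrite ?big_nil ?big_cons //= IH. Qed.

Lemma RtoC_sum (X : Type) (F : seq X) (P : pred X) (g : X -> R) :
  RtoC (\big[Rplus/IZR 0]_(x <- F | P x) g x) = (\sum_(x <- F | P x) RtoC (g x))%R.
Proof. exact: (big_morph RtoC RtoC_plus). Qed.

Lemma Cmod_prod (X : Type) (F : seq X) (f : X -> C) :
  RtoC (Cmod (\prod_(x <- F) f x)%R) = (\prod_(x <- F) RtoC (Cmod (f x)))%R.
Proof.
elim: F => [|x F IH]; rewrite ?big_nil ?big_cons; first by rewrite Cmod_1.
by rewrite Cmod_mult RtoC_mult IH.
Qed.

Lemma sumR_ge0 (X : Type) (F : seq X) (P : pred X) (g : X -> R) :
  (forall x, 0 <= g x) -> 0 <= \big[Rplus/0]_(x <- F | P x) g x.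
Proof.
move=> g0; apply: big_ind => // [|x y]; [exact: Rle_refl | exact: Rplus_le_le_0_compat].
Qed.

Lemma sumR_le (X : eqType) (F : seq X) (P : pred X) (g h : X -> R) :
  (forall x, x \in F -> P x -> g x <= h x) ->
  \big[Rplus/0]_(x <- F | P x) g x <= \big[Rplus/0]_(x <- F | P x) h x.
Proof.
move=> gh; rewrite big_seq_cond [X in _ <= X]big_seq_cond.
apply: (big_ind2 Rle) => [|*|x /andP[]]; [exact: Rle_refl | exact: Rplus_le_compat | exact: gh].
Qed.

Lemma sumR_scal (X : Type) (F : seq X) (c : R) (g : X -> R) :
  \big[Rplus/0]_(x <- F) (c * g x) = c * \big[Rplus/0]_(x <- F) g x.
Proof.
by apply: esym; apply: (big_morph (Rmult c)); [exact: Rmult_plus_distr_l | exact: Rmult_0_r].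
Qed.

Lemma Cmod_sum_le (X : Type) (F : seq X) (P : pred X) (f : X -> C) :
  Cmod (\sum_(x <- F | P x) f x)%R <= \big[Rplus/0]_(x <- F | P x) Cmod (f x).
Proof.
apply: (big_ind2 (fun z r => Cmod z <= r)); first by rewrite Cmod_0; exact: Rle_refl.
  move=> z r w s zr ws; apply: Rle_trans (Cmod_triangle z w) _.
  exact: Rplus_le_compat.
by move=> x _; exact: Rle_refl.
Qed.

Lemma big_subset (V : Type) (idx : V) (op : Monoid.com_law idx) (X : eqType)
    (F G : seq X) (g : X -> V) :
  uniq F -> uniq G -> {subset F <= G} ->
  \big[op/idx]_(x <- G) g x =
  op (\big[op/idx]_(x <- F) g x) (\big[op/idx]_(x <- G | x \notin F) g x).
Proof.
move=> uF uG FG; rewrite (bigID (mem F)) /=; congr (op _ _).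
rewrite -big_filter; apply: perm_big; apply: uniq_perm; rewrite ?filter_uniq //.
by move=> x; rewrite mem_filter; apply: andb_idr => /FG.
Qed.

Definition Cto (u : nat -> C) (l : C) : Prop :=
  forall eps : R, 0 < eps ->
    exists n0 : nat, forall n : nat, (n0 <= n)%N -> Cmod (Cminus (u n) l) < eps.

Lemma Cto_ext (u v : nat -> C) l : (forall n, u n = v n) -> Cto u l -> Cto v l.
Proof.
by move=> uv ul eps /ul[n0 H]; exists n0 => n /H; rewrite uv.
Qed.

Lemma Cto_const l : Cto (fun=> l) l.
Proof.
by move=> eps eps0; exists 0%N => n _; rewrite /Cminus Cplus_opp_r Cmod_0.
Qed.

Lemma Cto_unique u l l' : Cto u l -> Cto u l' -> l = l'.
Proof.
move=> ul ul'; have [//|ne] := EM (l = l').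
have ne0 : Cminus l l' <> RtoC 0 by move=> ll0; apply: ne; apply/Ceq_minus.
have d0 : 0 < Cmod (Cminus l l') by apply/Cmod_gt_0.
have [n1 H1] := ul (Cmod (Cminus l l') / 2) ltac:(lra).
have [n2 H2] := ul' (Cmod (Cminus l l') / 2) ltac:(lra).
have {}H1 := H1 (maxn n1 n2) (leq_maxl _ _).
have {}H2 := H2 (maxn n1 n2) (leq_maxr _ _).
have E : Cminus l l' = Cplus (Copp (Cminus (u (maxn n1 n2)) l)) (Cminus (u (maxn n1 n2)) l').
  by rewrite /Cminus; ring.
have := Cmod_triangle (Copp (Cminus (u (maxn n1 n2)) l)) (Cminus (u (maxn n1 n2)) l').
rewrite -E Cmod_opp; lra.
Qed.

Lemma Cto_add u v l k : Cto u l -> Cto v k -> Cto (fun n => Cplus (u n) (v n)) (Cplus l k).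
Proof.
move=> ul vk eps eps0.
have [n1 H1] := ul (eps / 2) ltac:(lra); have [n2 H2] := vk (eps / 2) ltac:(lra).
exists (maxn n1 n2) => n; rewrite geq_max => /andP[/H1 h1 /H2 h2].
have -> : Cminus (Cplus (u n) (v n)) (Cplus l k) = Cplus (Cminus (u n) l) (Cminus (v n) k).
  by rewrite /Cminus; ring.
have := Cmod_triangle (Cminus (u n) l) (Cminus (v n) k); lra.
Qed.

Lemma Cto_mul u v l k : Cto u l -> Cto v k -> Cto (fun n => Cmult (u n) (v n)) (Cmult l k).
Proof.
move=> ul vk eps eps0; have l0 := Cmod_ge_0 l; have k0 := Cmod_ge_0 k.
set M := Cmod l + Cmod k + 1; have M0 : 0 < M by rewrite /M; lra.
(* If both errors are below [Rmin 1 (eps / M)], the product error is below that number times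
   [1 + Cmod k + Cmod l], which is [M]. *)
have e0 : 0 < Rmin 1 (eps / M).
  by apply: Rmin_pos; [lra | apply: Rdiv_lt_0_compat].
have [n1 H1] := ul _ e0; have [n2 H2] := vk _ e0.
exists (maxn n1 n2) => n; rewrite geq_max => /andP[/H1 h1 /H2 h2].
set a := Cminus (u n) l in h1; set b := Cminus (v n) k in h2.
have -> : Cminus (Cmult (u n) (v n)) (Cmult l k) =
          Cplus (Cmult a (Cplus b k)) (Cmult l b) by rewrite /a /b /Cminus; ring.
apply: Rle_lt_trans (Cmod_triangle _ _) _; rewrite !Cmod_mult.
have a0 := Cmod_ge_0 a; have b0 := Cmod_ge_0 b.
have bk := Cmod_triangle b k; have m1 := Rmin_l 1 (eps / M).
have m2 : Rmin 1 (eps / M) * M <= eps.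
  have := Rmin_r 1 (eps / M) => /(Rmult_le_compat_r M) => /(_ ltac:(lra)).
  by have -> : eps / M * M = eps by field; lra.
have : Cmod a * Cmod (Cplus b k) <= Cmod a * (1 + Cmod k) by apply: Rmult_le_compat_l; lra.
have : Cmod l * Cmod b <= Cmod l * Rmin 1 (eps / M) by apply: Rmult_le_compat_l; lra.
have : Cmod a * (1 + Cmod k) < Rmin 1 (eps / M) * (1 + Cmod k).
  by apply: Rmult_lt_compat_r; lra.
by move: m2; rewrite /M; lra.
Qed.

Lemma Cto_sum (I : Type) (s : seq I) (u : nat -> I -> C) (l : I -> C) :
  (forall i, Cto (fun n => u n i) (l i)) ->
  Cto (fun n => \sum_(i <- s) u n i)%R (\sum_(i <- s) l i)%R.
Proof.
move=> ul; elim: s => [|i s IH].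
  by apply: Cto_ext (Cto_const _) => n; rewrite !big_nil.
rewrite big_cons; apply: Cto_ext (Cto_add (ul i) IH) => n.
by rewrite big_cons.
Qed.

Lemma Cto_prod (I : Type) (s : seq I) (u : nat -> I -> C) (l : I -> C) :
  (forall i, Cto (fun n => u n i) (l i)) ->
  Cto (fun n => \prod_(i <- s) u n i)%R (\prod_(i <- s) l i)%R.
Proof.
move=> ul; elim: s => [|i s IH].
  by apply: Cto_ext (Cto_const _) => n; rewrite !big_nil.
rewrite big_cons; apply: Cto_ext (Cto_mul (ul i) IH) => n.
by rewrite big_cons.
Qed.

Lemma Cto_bound u l K : Cto u l -> (forall n, Cmod (u n) <= K) -> Cmod l <= K.
Proof.
move=> ul uK; apply: Rnot_lt_le => lt_K.
have [n0 /(_ n0 (leqnn _)) H] := ul (Cmod l - K) ltac:(lra).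
have := Cmod_triangle (u n0) (Copp (Cminus (u n0) l)); rewrite Cmod_opp.
have -> : Cplus (u n0) (Copp (Cminus (u n0) l)) = l by rewrite /Cminus; ring.
by have := uK n0; lra.
Qed.

Lemma Cto_cauchy (u : nat -> C) :
  (forall eps, 0 < eps -> exists n0, forall n m, (n0 <= n <= m)%N ->
     Cmod (Cminus (u m) (u n)) < eps) ->
  exists l, Cto u l.
Proof.
move=> cau.
have comp (h : C -> R) : (forall a b, Rabs (h a - h b) <= Cmod (Cminus a b)) ->
    exists l : R, is_lim_seq (fun n => h (u n)) l.
  move=> hle; apply/ex_lim_seq_cauchy_corr => eps.
  have [n0 H] := cau (pos eps) (cond_pos eps); exists n0 => n m /leP le_n /leP le_m.
  case/orP: (leq_total n m) => le_nm.
    rewrite Rabs_minus_sym; apply: Rle_lt_trans (hle _ _) (H _ _ _).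
    by rewrite le_n.
  by apply: Rle_lt_trans (hle _ _) (H _ _ _); rewrite le_m.
have cc := fun a b => Rmax_Cmod (Cminus a b).
have [|x xl] := comp Re.
  by move=> a b; apply: Rle_trans (cc a b); apply: Rmax_l.
have [|y yl] := comp Im.
  by move=> a b; apply: Rle_trans (cc a b); apply: Rmax_r.
exists (x, y) => eps eps0.
(* The modulus is at most [sqrt 2] times the larger component; the factor 2 restores strictness
   after taking the maximum. *)
have e0 : 0 < eps / 2 / sqrt 2.
  by apply: Rdiv_lt_0_compat; [lra | apply: sqrt_lt_R0; lra].
have [n1 H1] := proj2 (is_lim_seq_spec _ _) xl (mkposreal _ e0).
have [n2 H2] := proj2 (is_lim_seq_spec _ _) yl (mkposreal _ e0).
exists (maxn n1 n2) => n; rewrite geq_max => /andP[/leP/H1 /= h1 /leP/H2 /= h2].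
apply: Rle_lt_trans (Cmod_2Rmax _) _.
have s0 : 0 < sqrt 2 by apply: sqrt_lt_R0; lra.
have : Rmax (Rabs (fst (Cminus (u n) (x, y)))) (Rabs (snd (Cminus (u n) (x, y)))) <=
    eps / 2 / sqrt 2 by apply: Rmax_lub; apply: Rlt_le.
move=> /(Rmult_le_compat_l (sqrt 2)) => /(_ (Rlt_le _ _ s0)).
have -> : sqrt 2 * (eps / 2 / sqrt 2) = eps / 2 by field; lra.
lra.
Qed.

(** * Unconditional sums computed along exhausting sequences *)

Section Exhaustion.

Variables (X : eqType) (P : pred X) (f : X -> C) (L : nat -> seq X) (K : R).
Hypothesis uniq_L : forall n, uniq (L n).
Hypothesis all_L : forall n, all P (L n).
Hypothesis incr_L : forall n, {subset L n <= L n.+1}.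
Hypothesis cover_L : forall x, P x -> exists n, x \in L n.
Hypothesis bound_L : forall n, \big[Rplus/0]_(x <- L n) Cmod (f x) <= K.

Lemma exhaust_mono m n : (m <= n)%N -> {subset L m <= L n}.
Proof.
move=> /subnK <-; elim: (n - m)%N => [//|k IH] x /IH; exact: incr_L.
Qed.

Lemma exhaust_cover (F : seq X) : all P F -> exists n, {subset F <= L n}.
Proof.
elim: F => [|x F IH] /=; first by exists 0%N.
move=> /andP[/cover_L[m xm] /IH[n Fn]]; exists (maxn m n) => y.
rewrite inE => /predU1P[->|/Fn]; first exact: exhaust_mono (leq_maxl _ _) _ xm.
exact: exhaust_mono (leq_maxr _ _) _.
Qed.

(** The absolute sums [A n] increase and are bounded, hence Cauchy. For [F] between [L n] and [L m]
    the sums over [F] and [L n] differ by at most [A m - A n]; this gives the limit along [L] and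
    its independence of the order. *)
Lemma exhaust_HasSum :
  exists S, HasSum P f S /\ Cto (fun n => csum (L n) f) S.
Proof.
pose A n := \big[Rplus/0]_(x <- L n) Cmod (f x).
have diff (F : seq X) n m : uniq F -> {subset L n <= F} -> {subset F <= L m} ->
    Cmod (Cminus (csum F f) (csum (L n) f)) <= A m - A n.
  move=> uF LF FL; rewrite !csum_bigE.
  rewrite [X in Cminus X _](big_subset _ _ (uniq_L n)) //=.
  have -> (a b : C) : Cminus (Cplus a b) a = b by rewrite /Cminus; ring.
  apply: Rle_trans (Cmod_sum_le _ _ _) _.
  have EF : \big[Rplus/0]_(x <- F) Cmod (f x) =
      A n + \big[Rplus/0]_(x <- F | x \notin L n) Cmod (f x).
    exact: big_subset (uniq_L n) uF LF.
  have EL : A m = \big[Rplus/0]_(x <- F) Cmod (f x) +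
      \big[Rplus/0]_(x <- L m | x \notin F) Cmod (f x).
    exact: big_subset uF (uniq_L m) FL.
  have : 0 <= \big[Rplus/0]_(x <- L m | x \notin F) Cmod (f x).
    by apply: sumR_ge0 => x; apply: Cmod_ge_0.
  by rewrite /= EL EF; lra.
have A_incr n : A n <= A n.+1.
  have -> : A n.+1 = A n + \big[Rplus/0]_(x <- L n.+1 | x \notin L n) Cmod (f x).
    exact: big_subset (uniq_L n) (uniq_L n.+1) (@incr_L n).
  have : 0 <= \big[Rplus/0]_(x <- L n.+1 | x \notin L n) Cmod (f x).
    by apply: sumR_ge0 => x; apply: Cmod_ge_0.
  lra.
have A_cauchy eps : 0 < eps ->
    exists n0, forall n m, (n0 <= n <= m)%N -> A m - A n < eps.
  move=> eps0; have /ex_lim_seq_cauchy_corr := ex_finite_lim_seq_incr A K A_incr bound_L.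
  move=> /(_ (mkposreal eps eps0))[n0 /= H]; exists n0 => n m /andP[le_n le_m].
  have := H m n (leP (leq_trans le_n le_m)) (leP le_n).
  by have := Rle_abs (A m - A n); lra.
have [S LS] : exists S, Cto (fun n => csum (L n) f) S.
  apply: Cto_cauchy => eps /A_cauchy[n0 H]; exists n0 => n m lenm.
  apply: Rle_lt_trans (diff _ _ m (uniq_L m) _ _) (H _ _ lenm) => //.
  by case/andP: lenm => _; apply: exhaust_mono.
exists S; split=> // eps eps0.
have [n1 H1] := LS (eps / 2) ltac:(lra); have [n2 H2] := A_cauchy (eps / 2) ltac:(lra).
set n := maxn n1 n2; exists (L n); split=> // F uF allF LF.
have [m Fm] := exhaust_cover allF.
have Fm' : {subset F <= L (maxn n m)}.
  by move=> x /Fm; apply: exhaust_mono; apply: leq_maxr.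
have := diff F n (maxn n m) uF LF Fm'; have := H2 n (maxn n m).
rewrite leq_maxr leq_maxl => /(_ isT); have := H1 n (leq_maxl _ _).
have := Cmod_triangle (Cminus (csum F f) (csum (L n) f)) (Cminus (csum (L n) f) S).
have -> : Cplus (Cminus (csum F f) (csum (L n) f)) (Cminus (csum (L n) f) S) =
          Cminus (csum F f) S by rewrite /Cminus; ring.
lra.
Qed.

End Exhaustion.

Lemma HasSum_unique (X : eqType) (P : pred X) (f : X -> C) S S' :
  HasSum P f S -> HasSum P f S' -> S = S'.
Proof.
move=> fS fS'; apply: (@Cto_unique (fun=> S)); first exact: Cto_const.
move=> eps eps0; exists 0%N => _ _.
have [F1 [P1 H1]] := fS (eps / 2) ltac:(lra).
have [F2 [P2 H2]] := fS' (eps / 2) ltac:(lra).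
pose F := undup (F1 ++ F2).
have PF : all P F.
  by apply/allP => x; rewrite mem_undup mem_cat => /orP[/(allP P1)|/(allP P2)].
have {}H1 : Cmod (Cminus (csum F f) S) < eps / 2.
  by apply: H1 (undup_uniq _) PF _ => x; rewrite mem_undup mem_cat => ->.
have {}H2 : Cmod (Cminus (csum F f) S') < eps / 2.
  by apply: H2 (undup_uniq _) PF _ => x; rewrite mem_undup mem_cat => ->; rewrite orbT.
have := Cmod_triangle (Copp (Cminus (csum F f) S)) (Cminus (csum F f) S').
have -> : Cplus (Copp (Cminus (csum F f) S)) (Cminus (csum F f) S') = Cminus S S'.
  by rewrite /Cminus; ring.
rewrite Cmod_opp; lra.
Qed.

Lemma usumE (X : eqType) (P : pred X) (f : X -> C) S : HasSum P f S -> usum P f = S.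
Proof.
move=> fS; apply: (HasSum_unique _ fS).
by rewrite /usum; apply: ClassicalEpsilon.epsilon_spec; exists S.
Qed.

(** Dominated convergence when the range of summation also grows: beyond a fixed [n0] the tail of
    [g] is small, and the head is a finite sum of null sequences. *)
Lemma tannery (u : nat -> nat -> C) (g : nat -> R) (K : R) :
  (forall n v, (0 < v)%N -> Cmod (u n v) <= g v) ->
  (forall n, \big[Rplus/0]_(1 <= v < n.+1) g v <= K) ->
  (forall v, (0 < v)%N -> Cto (fun n => u n v) (RtoC 0)) ->
  Cto (fun n => \sum_(1 <= v < n.+1) u n v)%R (RtoC 0).
Proof.
move=> ug gK u0 eps eps0.
pose A n := \big[Rplus/0]_(1 <= v < n.+1) g v.
have g0 v : (0 < v)%N -> 0 <= g v.
  by move=> v0; apply: Rle_trans (Cmod_ge_0 (u 0%N v)) (ug _ _ v0).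
have A_incr n : A n <= A n.+1.
  have -> : A n.+1 = A n + g n.+1 by rewrite /A big_nat_recr.
  by have := g0 n.+1 isT; lra.
have /ex_lim_seq_cauchy_corr cau := ex_finite_lim_seq_incr A K A_incr gK.
have e20 : 0 < eps / 2 by lra.
have [n0 /= tail] := cau (mkposreal _ e20).
have [n1 head] : exists n1, forall n, (n1 <= n)%N ->
    Cmod (\sum_(1 <= v < n0.+1) u n v)%R < eps / 2.
  (* [Cto_sum] asks for convergence at every index, so the term at 0, outside the range, is replaced
     by 0. *)
  have H : Cto (fun n => \sum_(1 <= v < n0.+1) (if (0 < v)%N then u n v else RtoC 0))%R
             (RtoC 0).
    have {2}<- : (\sum_(1 <= v < n0.+1) RtoC 0)%R = RtoC 0 by rewrite big1.
    by apply: Cto_sum => v; case: (ltnP 0 v) => [/u0 //|_]; apply: Cto_const.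
  have [n1 {}H] := H _ e20; exists n1 => n /H.
  have -> a : Cminus a (RtoC 0) = a by rewrite /Cminus; ring.
  congr (Cmod _ < _); apply: eq_big_nat => v /andP[v0 _].
  by rewrite v0.
exists (maxn n0 n1) => n; rewrite geq_max => /andP[le_n0 /head {}head].
have -> a : Cminus a (RtoC 0) = a by rewrite /Cminus; ring.
rewrite (@big_cat_nat _ _ _ n0.+1) //=.
apply: Rle_lt_trans (Cmod_triangle _ _) _.
have := tail n n0 (leP le_n0) (leP (leqnn _)).
rewrite /A (@big_cat_nat _ _ _ n0.+1 1 n.+1) //=.
have T : Cmod (\sum_(n0.+1 <= v < n.+1) u n v)%R <= \big[Rplus/0]_(n0.+1 <= v < n.+1) g v.
  apply: Rle_trans (Cmod_sum_le _ _ _) _; apply: sumR_le => v.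
  by rewrite mem_index_iota => /andP[lt_v _] _; apply: ug; apply: leq_trans lt_v.
set a := \big[_/_]_(1 <= i < _) g i; set b := \big[_/_]_(n0.+1 <= i < _) g i in T *.
move=> h; have {}h : Rabs (a + b - a) < eps / 2 := h.
change (Cmod (\sum_(1 <= v < n0.+1) u n v)%R + Cmod (\sum_(n0.+1 <= v < n.+1) u n v)%R < eps).
have := Rle_abs (a + b - a); lra.
Qed.

(** * Hurwitz-type sums *)

(** The real power [v^(-s)], which is the modulus of [cnpow]. *)
Definition npow (v : nat) (s : R) : R := exp (- s * ln (INR v)).

Lemma npow_gt0 v s : 0 < npow v s. Proof. exact: exp_pos. Qed.

Lemma npow_le v s t : (0 < v)%N -> s <= t -> npow v t <= npow v s.
Proof.
move=> v0 st; have v1 : 1 <= INR v by apply: (le_INR 1); apply/leP.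
have l0 : 0 <= ln (INR v) by rewrite -ln_1; apply: Rcomplements.ln_le; lra.
have : - t * ln (INR v) <= - s * ln (INR v) by apply: Rmult_le_compat_r; lra.
by rewrite /npow; case=> [lt|->]; [left; apply: exp_increasing | right].
Qed.

Lemma npow_anti u v s : (0 < u <= v)%N -> 0 <= s -> npow v s <= npow u s.
Proof.
move=> /andP[u0 uv] s0; have u1 : 1 <= INR u by apply: (le_INR 1); apply/leP.
have le_uv : INR u <= INR v by apply: le_INR; apply/leP.
have : ln (INR u) <= ln (INR v) by apply: Rcomplements.ln_le; lra.
move=> /(Rmult_le_compat_l s) => /(_ s0) h.
have : - s * ln (INR v) <= - s * ln (INR u) by lra.
by rewrite /npow; case=> [lt|->]; [left; apply: exp_increasing | right].
Qed.

Lemma npowD v s t : npow v (s + t) = npow v s * npow v t.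
Proof. by rewrite /npow -exp_plus; congr exp; lra. Qed.

Lemma Cmod_cnpow v (w : C) : Cmod (cnpow (INR v) w) = npow v (Re w).
Proof.
rewrite /cnpow Cmod_mult Cmod_R Rabs_pos_eq; last by left; apply: exp_pos.
set t := Im w * _; have -> : Cmod (cos t, - sin t) = 1.
  rewrite /Cmod /= -[RHS]sqrt_1; congr sqrt.
  by have := sin2_cos2 t; rewrite /Rsqr; lra.
by rewrite Rmult_1_r.
Qed.

(** From [ln((v+1)/v) >= 1/(v+1)] and [exp x >= 1 + x]. The constant reduces the last comparison to
    [(1 + dl) v >= 1 + dl]. *)
Lemma npow_telescope (dl : R) v : 0 < dl -> (0 < v)%N ->
  npow v (1 + dl) <= (2 + dl) / dl * (npow v dl - npow v.+1 dl).
Proof.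
move=> dl0 v0; have v1 : 1 <= INR v by apply: (le_INR 1); apply/leP.
rewrite npowD; have p1 : npow v 1 = / INR v.
  rewrite /npow (_ : - (1) * _ = - ln (INR v)); last by lra.
  by rewrite exp_Ropp exp_ln //; lra.
set l := ln (INR v.+1) - ln (INR v).
have -> : npow v.+1 dl = npow v dl * exp (- (dl * l)).
  by rewrite /npow -exp_plus /l; congr exp; lra.
have lge : / (INR v + 1) <= l.
  have := exp_ineq1_le (- l); have -> : exp (- l) = INR v / (INR v + 1).
    rewrite /l (_ : - _ = ln (INR v) + - ln (INR v.+1)); last by lra.
    by rewrite exp_plus exp_Ropp !exp_ln // ?S_INR; lra.
  have -> : INR v / (INR v + 1) = 1 - / (INR v + 1) by field; lra.
  lra.
have i0 : 0 < / (INR v + 1) by apply: Rinv_0_lt_compat; lra.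
set t := dl * / (INR v + 1).
have t0 : 0 < t by apply: Rmult_lt_0_compat.
have tl : t <= dl * l by apply: Rmult_le_compat_l; lra.
have ele : exp (- (dl * l)) <= / (1 + t).
  rewrite exp_Ropp; apply: Rinv_le_contravar; first by lra.
  by have := exp_ineq1_le (dl * l); lra.
have key : / INR v <= (2 + dl) / dl * (1 - / (1 + t)).
  have -> : (2 + dl) / dl * (1 - / (1 + t)) = (2 + dl) / (INR v + 1 + dl).
    by rewrite /t; field; repeat split; nra.
  apply: (Rmult_le_reg_r (INR v * (INR v + 1 + dl))); first by nra.
  have -> : / INR v * (INR v * (INR v + 1 + dl)) = INR v + 1 + dl by field; lra.
  have -> : (2 + dl) / (INR v + 1 + dl) * (INR v * (INR v + 1 + dl)) = (2 + dl) * INR v.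
    by field; lra.
  by nra.
rewrite p1 Rmult_comm.
have -> : (2 + dl) / dl * (npow v dl - npow v dl * exp (- (dl * l))) =
          npow v dl * ((2 + dl) / dl * (1 - exp (- (dl * l)))) by field; lra.
apply: Rmult_le_compat_l; first by left; apply: npow_gt0.
apply: Rle_trans key _; apply: Rmult_le_compat_l; last by lra.
by left; apply: Rdiv_lt_0_compat; lra.
Qed.

Lemma npow_tail (dl : R) u n : 0 < dl -> (0 < u)%N ->
  \big[Rplus/0]_(u <= v < n) npow v (1 + dl) <= (2 + dl) / dl * npow u dl.
Proof.
move=> dl0 u0; have K0 : 0 < (2 + dl) / dl by apply: Rdiv_lt_0_compat; lra.
case: (leqP u n) => [le_un|lt_nu]; last first.
  rewrite big_geq; last exact: ltnW.
  by left; apply: Rmult_lt_0_compat => //; apply: npow_gt0.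
suff : \big[Rplus/0]_(u <= v < n) npow v (1 + dl) <=
    (2 + dl) / dl * (npow u dl - npow n dl).
  by have := Rmult_lt_0_compat _ _ K0 (npow_gt0 n dl); lra.
elim: n le_un => [|n IH]; first by case: u u0.
rewrite leq_eqVlt => /predU1P[<-|]; first by rewrite big_geq //; lra.
rewrite ltnS => le_un; rewrite big_nat_recr //=.
have := IH le_un; have := npow_telescope dl0 (leq_trans u0 le_un); lra.
Qed.

Section ChainBounds.

Variables (d : nat) (dl : R).
Hypothesis dl_gt0 : 0 < dl.

(** One tail summation lowers the exponent of decay from [1 + dl] to [dl]. *)
Lemma chain_tail_bound (n : nat) (X : nat -> nat -> C) e c K v :
  0 <= K ->
  (forall a, (0 < a)%N -> Cmod (X c.+1 a) * Cmod (chain d n X e c.+1 a) <= K * npow a (1 + dl)) ->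
  (0 < v)%N -> Cmod (chain d n X e.+1 c v) <= K * ((2 + dl) / dl) * npow v dl.
Proof.
move=> K0 XK v0 /=; apply: Rle_trans (Cmod_sum_le _ _ _) _.
have K1 : 0 < (2 + dl) / dl by apply: Rdiv_lt_0_compat; lra.
have vd0 : (0 < v + d)%N by rewrite addn_gt0 v0.
apply: (Rle_trans _ (\big[Rplus/0]_(v + d <= a < n.+1) (K * npow a (1 + dl)))).
  apply: sumR_le => a; rewrite mem_index_iota => /andP[le_a _] _.
  by rewrite Cmod_mult; apply: XK; apply: leq_trans le_a.
rewrite sumR_scal Rmult_assoc; apply: Rmult_le_compat_l => //.
apply: Rle_trans (npow_tail _ dl_gt0 vd0) _; apply: Rmult_le_compat_l; first by lra.
by apply: npow_anti; [rewrite v0 leq_addr | lra].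
Qed.

(** Working inwards from the last variable, a summation costs one power and the next weight, of
    exponent at least 1, pays it back. So only the last exponent has to exceed 1. [K] does not
    depend on [n]. *)
Lemma chain_decay e : exists2 K, 0 <= K & forall n (X : nat -> nat -> C) c,
  (forall k a, (c <= k <= c + e)%N -> (0 < a)%N -> Cmod (X k a) <= npow a 1) ->
  (forall a, (0 < a)%N -> Cmod (X (c + e)%N a) <= npow a (1 + dl)) ->
  forall v, (0 < v)%N -> Cmod (X c v) * Cmod (chain d n X e c v) <= K * npow v (1 + dl).
Proof.
elim: e => [|e [K K0 IH]].
  exists 1 => [|n X c _ Xlast v v0]; first by lra.
  by move: (Xlast v v0); rewrite addn0 /= Cmod_1; lra.
exists (K * ((2 + dl) / dl)) => [|n X c X1 Xlast v v0].
  by apply: Rmult_le_pos => //; left; apply: Rdiv_lt_0_compat; lra.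
have XK a : (0 < a)%N -> Cmod (X c.+1 a) * Cmod (chain d n X e c.+1 a) <= K * npow a (1 + dl).
  apply: IH => [k {}a /andP[le_k ge_k]|{}a]; last by rewrite addSnnS; apply: Xlast.
  by apply: X1; rewrite (ltnW le_k) -addSnnS.
have B := chain_tail_bound K0 XK v0.
rewrite npowD; apply: Rle_trans (Rmult_le_compat _ _ _ _ (Cmod_ge_0 _) (Cmod_ge_0 _) _ B) _.
  by apply: (X1 c v) => //; rewrite leqnn leq_addr.
by right; ring.
Qed.

(** Here the weight at [c] is left out: the estimate serves the legs, whose corner weight is already
    spent on the arm. *)
Lemma chain_bounded e : exists2 K, 0 <= K & forall n (X : nat -> nat -> C) c,
  (forall k a, (c < k <= c + e)%N -> (0 < a)%N -> Cmod (X k a) <= npow a 1) ->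
  (forall a, (0 < e)%N -> (0 < a)%N -> Cmod (X (c + e)%N a) <= npow a (1 + dl)) ->
  forall v, (0 < v)%N -> Cmod (chain d n X e c v) <= K.
Proof.
case: e => [|e]; first by exists 1 => [|n X c _ _ v _ /=]; rewrite ?Cmod_1; lra.
have [K K0 H] := chain_decay e.
have K1 : 0 <= K * ((2 + dl) / dl).
  by apply: Rmult_le_pos => //; left; apply: Rdiv_lt_0_compat; lra.
exists (K * ((2 + dl) / dl)) => // n X c X1 Xlast v v0.
have XK a : (0 < a)%N -> Cmod (X c.+1 a) * Cmod (chain d n X e c.+1 a) <= K * npow a (1 + dl).
  apply: H => [k {}a|{}a]; first by rewrite addSnnS; apply: X1.
  by rewrite addSnnS; apply: Xlast.
apply: Rle_trans (chain_tail_bound K0 XK v0) _.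
have : npow v dl <= npow v 0 by apply: npow_le => //; lra.
have -> : npow v 0 = 1 by rewrite /npow Ropp_0 Rmult_0_l exp_0.
move=> /(Rmult_le_compat_l _ _ _ K1); lra.
Qed.

End ChainBounds.

(** The increments of the words summed in [chain], which are the summation variables of the zeta
    sums. *)
Fixpoint offsets (d n r v : nat) : seq (seq nat) :=
  if r is r'.+1 then
    [seq (t - v)%N :: a | t <- index_iota (v + d) n.+1, a <- offsets d n r' t]
  else [:: [::]].

(** For [r = 0] the empty word is listed whatever [v] and [n] are, hence the disjunction. *)
Lemma mem_offsets d n r v a :
  (a \in offsets d n r v) =
  [&& size a == r, all (leq d) a & (r == 0%N) || (v + sumn a <= n)%N].
Proof.
elim: r v a => [|r IH] v a /=; first by case: a.
apply/allpairsPdep/idP => [[t [a' []]]|].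
  rewrite mem_index_iota IH => /andP[le_t lt_t] /and3P[sa Ha le_n] -> /=.
  rewrite eqSS sa Ha andbT /=; case/orP: le_n => [/eqP r0|le_n]; last by lia.
  by move: sa; rewrite r0 size_eq0 => /eqP -> /=; lia.
case: a => [//|x a] /= /and3P[sa /andP[dx Ha] le_n]; exists (v + x)%N, a; split.
- by rewrite mem_index_iota; lia.
- by rewrite IH Ha -eqSS sa /=; apply/orP; right; lia.
- by rewrite addKn.
Qed.

Lemma offsets_uniq d n r v : uniq (offsets d n r v).
Proof.
elim: r v => [//|r IH] v /=; apply: allpairs_uniq_dep => //; first exact: iota_uniq.
move=> x y /allpairsPdep[t [a [tI _ ->]]] /allpairsPdep[t' [a' [tI' _ ->]]] /=.
move: tI tI'; rewrite !mem_index_iota => /andP[le_t _] /andP[le_t' _] [eq_t ->].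
suff -> : t = t' by [].
by move: (leq_trans (leq_addr _ _) le_t) (leq_trans (leq_addr _ _) le_t'); lia.
Qed.

Lemma sum_offsets (A : comNzRingType) (X : nat -> nat -> A) d n r c v :
  (\sum_(a <- offsets d n r v) \prod_(j <- iota 0 r) X (c + j).+1 (v + psum a j)%N)%R =
  chain d n X r c v.
Proof.
elim: r c v => [|r IH] c v /=; first by rewrite big_seq1 big_nil.
rewrite big_allpairs_dep big_seq [RHS]big_seq; apply: eq_bigr => t.
rewrite mem_index_iota => /andP[le_t _]; rewrite -IH mulr_sumr.
have vt : (v <= t)%N by apply: leq_trans le_t; apply: leq_addr.
apply: eq_bigr => a _; rewrite big_cons /psum /= take0 /= !addn0 subnKC //.
congr (_ * _)%R; rewrite -[1%N]addn0 iotaDl big_map; apply: eq_bigr => j _ /=.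
by rewrite add1n addSnnS addnA subnKC.
Qed.

(** The [offsets] lists exhaust the index set, and their partial sums are the truncated chains. *)
Lemma zeta_lim (d r v : nat) (w : nat -> C) (dl : R) :
  0 < dl -> (0 < v)%N ->
  (forall j, (0 < j <= r)%N -> 1 <= Re (w j)) ->
  ((0 < r)%N -> 1 + dl <= Re (w r)) ->
  exists S,
    HasSum (fun a : seq nat => (size a == r) && all (leq d) a)
           (zetaBH_summand r w (INR v)) S /\
    Cto (fun n => chain d n (fun c a => cnpow (INR a) (w c)) r 0 v) S.
Proof.
move=> dl0 v0 w1 wr.
have [K K0 bnd] := chain_bounded d dl0 r.
have sumE a : zetaBH_summand r w (INR v) a =
    (\prod_(j <- iota 0 r) cnpow (INR (v + psum a j)) (w j.+1))%R.
  by rewrite /zetaBH_summand cprod_bigE; apply: eq_bigr => j _; rewrite plus_INR.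
have chainE n : csum (offsets d n r v) (zetaBH_summand r w (INR v)) =
    chain d n (fun c a => cnpow (INR a) (w c)) r 0 v.
  by rewrite csum_bigE -sum_offsets; apply: eq_bigr => a _; rewrite sumE.
suff [S [HS LS]] : exists S, HasSum (fun a : seq nat => (size a == r) && all (leq d) a)
    (zetaBH_summand r w (INR v)) S /\
    Cto (fun n => csum (offsets d n r v) (zetaBH_summand r w (INR v))) S.
  by exists S; split=> //; apply: Cto_ext LS.
apply: (@exhaust_HasSum _ _ _ _ K).
- by move=> n; apply: offsets_uniq.
- by move=> n; apply/allP => a; rewrite mem_offsets => /and3P[-> ->].
- move=> n a; rewrite !mem_offsets => /and3P[-> -> /=].
  by case/orP => [->//|le_n]; rewrite (leqW le_n) orbT.
- move=> a /andP[sa Ha]; exists (v + sumn a)%N.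
  by rewrite mem_offsets sa Ha leqnn orbT.
(* The sum of absolute values is itself a chain, for the weights replaced by their moduli, so [bnd]
   controls it. *)
move=> n; pose X c a := RtoC (Cmod (cnpow (INR a) (w c))).
have XE c a : Cmod (X c a) = npow a (Re (w c)).
  by rewrite Cmod_R Rabs_pos_eq; [exact: Cmod_cnpow | exact: Cmod_ge_0].
have : Cmod (chain d n X r 0 v) <= K.
  apply: bnd => //.
    by move=> k a Hk a0; rewrite XE; apply: npow_le => //; apply: w1.
  by move=> a r0 a0; rewrite XE; apply: npow_le => //; apply: wr.
rewrite -sum_offsets.
have -> : (\sum_(a <- offsets d n r v) \prod_(j <- iota 0 r) X (0 + j).+1 (v + psum a j)%N)%R
   = RtoC (\big[Rplus/0]_(a <- offsets d n r v) Cmod (zetaBH_summand r w (INR v) a)).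
  by rewrite RtoC_sum; apply: eq_bigr => a _; rewrite sumE Cmod_prod.
by rewrite Cmod_R; apply: Rle_trans (Rle_abs _).
Qed.

(** * Letting the bound on the entries tend to infinity *)

Lemma uniform_bound N (Q : nat -> R -> Prop) :
  (forall k K K', K <= K' -> Q k K -> Q k K') ->
  (forall k, (k < N)%N -> exists2 K, 0 <= K & Q k K) ->
  exists2 K, 0 <= K & forall k, (k < N)%N -> Q k K.
Proof.
move=> Q_mono; elim: N => [|N IH] HQ; first by exists 0 => //; lra.
have [K1 K10 H1] := IH (fun k lt_k => HQ k (ltnW lt_k)).
have [K2 K20 H2] := HQ N (ltnSn N).
exists (K1 + K2) => [|k]; first by lra.
rewrite ltnS leq_eqVlt => /predU1P[->|/H1]; first by apply: Q_mono H2; lra.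
by apply: Q_mono; lra.
Qed.

(** The bound is [N!] times [B^N]. *)
Lemma Cmod_perm_sum_le N (u : 'S_N -> C) (Y : 'S_N -> 'I_N -> C) B :
  (forall s, Cmod (u s) = 1) -> (forall s j, Cmod (Y s j) <= B) ->
  Cmod (\sum_(s : 'S_N) u s * \prod_(j < N) Y s j)%R <=
  \big[Rplus/0]_(s : 'S_N) pow B N.
Proof.
move=> u1 YB; apply: Rle_trans (Cmod_sum_le _ _ _) _; apply: sumR_le => s _ _.
rewrite Cmod_mult u1 Rmult_1_l {u1}.
move: (Y s) (YB s) => y {u s Y YB}; elim: N y => [|M IH] y yB.
  by rewrite big_ord0 Cmod_1 /=; lra.
rewrite big_ord_recl Cmod_mult /=; apply: Rmult_le_compat => //; try exact: Cmod_ge_0.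
by apply: IH.
Qed.

Lemma cnpow_prodn (m : seq nat) (w : C) : all (leq 1) m ->
  cnpow (INR (foldr muln 1%N m)) w = (\prod_(v <- m) cnpow (INR v) w)%R.
Proof.
have cnpowM x y : 0 < x -> 0 < y -> cnpow (x * y) w = Cmult (cnpow x w) (cnpow y w).
  move=> x0 y0; rewrite /cnpow ln_mult // Rmult_plus_distr_l exp_plus.
  rewrite Rmult_plus_distr_l cos_plus sin_plus /Cmult /=.
  by congr pair; ring.
elim: m => [_|v m IH /= /andP[v0 m0]].
  rewrite big_nil /= /cnpow ln_1 !Rmult_0_r exp_0 cos_0 sin_0 Ropp_0.
  by rewrite /Cmult /=; congr pair; ring.
rewrite big_cons -IH // -[(v * _)%N]/(muln v _) mult_INR cnpowM //.
  by apply: lt_0_INR; apply/ltP.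
apply: lt_0_INR; apply/ltP; elim: m m0 {IH} => [//|u m IH] /= /andP[u0 /IH m0].
by rewrite muln_gt0 u0.
Qed.

Section Limits.

Variables (la : seq nat) (z : Z -> C) (dl : R).
Hypothesis la_part : is_partition la.
Hypothesis dl_gt0 : 0 < dl.
Hypothesis z_ge1 : forall i j, in_diagram la i j -> 1 <= Re (z (content i j)).
Hypothesis zp_gt1 : forall i, (i < frobN la)%N -> 1 + dl <= Re (z (Z.of_nat (frob_p la i))).
Hypothesis zq_gt1 :
  forall i, (i < frobN la)%N -> 1 + dl <= Re (z (Z.opp (Z.of_nat (frob_q la i)))).

Let N := frobN la.

Lemma zp_ge1 k c : (k < N)%N -> (c <= frob_p la k)%N -> 1 <= Re (z (Z.of_nat c)).
Proof.
move=> lt_k le_c; have -> : Z.of_nat c = content k (k + c) by rewrite /content; lia.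
apply: z_ge1; rewrite /in_diagram.
by move: lt_k le_c; rewrite /N ltn_frobN // /frob_p; lia.
Qed.

Lemma zq_ge1 k c : (k < N)%N -> (c <= frob_q la k)%N -> 1 <= Re (z (Z.opp (Z.of_nat c))).
Proof.
move=> lt_k le_c; have -> : Z.opp (Z.of_nat c) = content (k + c) k by rewrite /content; lia.
apply: z_ge1; rewrite /in_diagram -ltn_conj_part //.
by move: lt_k le_c; rewrite /N ltn_frobN // -ltn_conj_part // /frob_q; lia.
Qed.

(** The truncated sum over the hook with corner entry [v], arm [p_k] and leg [q_j]. *)
Definition hook_term (W : Z -> nat -> C) (n k j v : nat) : C :=
  (W Z0 v * chain 0 n (fun c => W (Z.of_nat c)) (frob_p la k) 0 v *
   chain 1 n (fun c => W (Z.opp (Z.of_nat c))) (frob_q la j) 0 v)%R.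

Definition z_modulus (W : Z -> nat -> C) : Prop :=
  forall c v, Cmod (W c v) = npow v (Re (z c)).

(** The corner weight together with the arm decays like [v^(-1-dl)] and the leg is bounded. One [K]
    covers all [n] and all weights of the prescribed moduli, so both [W0] and [Wabs]. *)
Lemma hook_term_bound : exists2 K, 0 <= K &
  forall W n k j v, z_modulus W -> (k < N)%N -> (j < N)%N -> (0 < v)%N ->
    Cmod (hook_term W n k j v) <= K * npow v (1 + dl).
Proof.
have [K1 K10 H1] : exists2 K, 0 <= K & forall k, (k < N)%N ->
    forall W n v, z_modulus W -> (0 < v)%N ->
    Cmod (W Z0 v) * Cmod (chain 0 n (fun c => W (Z.of_nat c)) (frob_p la k) 0 v) <=
    K * npow v (1 + dl).
  apply: uniform_bound => [k K K' le_K H W n v Wz v0|k lt_k].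
    apply: Rle_trans (H W n v Wz v0) _; apply: Rmult_le_compat_r => //.
    by left; apply: npow_gt0.
  have [K K0 H] := chain_decay 0 dl_gt0 (frob_p la k); exists K => // W n v Wz v0.
  apply: (H n (fun c => W (Z.of_nat c)) 0%N) => // [c a Hc a0|a a0]; rewrite Wz.
    by apply: npow_le => //; apply: zp_ge1 lt_k _.
  by apply: npow_le => //; apply: zp_gt1.
have [K2 K20 H2] : exists2 K, 0 <= K & forall k, (k < N)%N ->
    forall W n v, z_modulus W -> (0 < v)%N ->
    Cmod (chain 1 n (fun c => W (Z.opp (Z.of_nat c))) (frob_q la k) 0 v) <= K.
  apply: uniform_bound => [k K K' le_K H W n v Wz v0|k lt_k].
    by apply: Rle_trans (H W n v Wz v0) _.
  have [K K0 H] := chain_bounded 1 dl_gt0 (frob_q la k); exists K => // W n v Wz v0.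
  apply: H => // [c a /andP[_ Hc] a0|a _ a0]; rewrite Wz.
    by apply: npow_le => //; apply: zq_ge1 lt_k _.
  by apply: npow_le => //; apply: zq_gt1.
exists (K1 * K2) => [|W n k j v Wz lt_k lt_j v0]; first exact: Rmult_le_pos.
rewrite /hook_term !Cmod_mult.
have := H1 k lt_k W n v Wz v0; have := H2 j lt_j W n v Wz v0.
set a := Cmod _; set b := _ * Cmod _ => h2 h1.
apply: Rle_trans (Rmult_le_compat _ _ _ _ _ _ h1 h2) _.
- by apply: Rmult_le_pos; apply: Cmod_ge_0.
- exact: Cmod_ge_0.
by right; ring.
Qed.

Let F k v := zetaBH (frob_p la k) (fun j => z (Z.of_nat j)) (INR v).
Let G k v := zetaH (frob_q la k) (fun j => z (Z.opp (Z.of_nat j))) (INR v).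
Let W0 c v := cnpow (INR v) (z c).
Let Wabs c v := RtoC (Cmod (W0 c v)).

Lemma W0_modulus : z_modulus W0.
Proof. by move=> c v; apply: Cmod_cnpow. Qed.

Lemma Wabs_modulus : z_modulus Wabs.
Proof.
move=> c v; rewrite /Wabs Cmod_R Rabs_pos_eq; first exact: W0_modulus.
exact: Cmod_ge_0.
Qed.

Lemma zetaBH_lim k v : (k < N)%N -> (0 < v)%N ->
  HasSum (zetaBH_dom (frob_p la k))
    (zetaBH_summand (frob_p la k) (fun j => z (Z.of_nat j)) (INR v)) (F k v) /\
  Cto (fun n => chain 0 n (fun c => W0 (Z.of_nat c)) (frob_p la k) 0 v) (F k v).
Proof.
move=> lt_k v0.
have [||S []] := @zeta_lim 0 (frob_p la k) v (fun j => z (Z.of_nat j)) dl dl_gt0 v0.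
- by move=> j /andP[_ le_j]; apply: zp_ge1 lt_k le_j.
- by move=> _; apply: zp_gt1.
have -> : (fun a : seq nat => (size a == frob_p la k) && all (leq 0) a) = zetaBH_dom (frob_p la k).
  by apply/funext => a; rewrite (eq_all (a2 := predT)) // all_predT andbT.
by move=> HS LS; rewrite /F /zetaBH (usumE HS).
Qed.

Lemma zetaH_lim k v : (k < N)%N -> (0 < v)%N ->
  HasSum (zetaH_dom (frob_q la k))
    (zetaBH_summand (frob_q la k) (fun j => z (Z.opp (Z.of_nat j))) (INR v)) (G k v) /\
  Cto (fun n => chain 1 n (fun c => W0 (Z.opp (Z.of_nat c))) (frob_q la k) 0 v) (G k v).
Proof.
move=> lt_k v0.
have [||S [HS LS]] := @zeta_lim 1 (frob_q la k) v (fun j => z (Z.opp (Z.of_nat j))) dl dl_gt0 v0.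
- by move=> j /andP[_ le_j]; apply: zq_ge1 lt_k le_j.
- by move=> _; apply: zq_gt1.
by rewrite /G /zetaH (usumE HS).
Qed.

Let hook k j v := (W0 Z0 v * F k v * G j v)%R.

Lemma hook_term_lim k j v : (k < N)%N -> (j < N)%N -> (0 < v)%N ->
  Cto (fun n => hook_term W0 n k j v) (hook k j v).
Proof.
move=> lt_k lt_j v0; apply: Cto_mul (proj2 (zetaH_lim lt_j v0)).
exact: Cto_mul (Cto_const _) (proj2 (zetaBH_lim lt_k v0)).
Qed.

Lemma hook_bound : exists2 K, 0 <= K & forall k j v, (k < N)%N -> (j < N)%N ->
  (0 < v)%N -> Cmod (hook k j v) <= K * npow v (1 + dl).
Proof.
have [K K0 bnd] := hook_term_bound; exists K => // k j v lt_k lt_j v0.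
apply: Cto_bound (hook_term_lim lt_k lt_j v0) _ => n.
by apply: bnd => //; apply: W0_modulus.
Qed.

Lemma npow_sum_bound K n : 0 <= K ->
  \big[Rplus/0]_(1 <= v < n) (K * npow v (1 + dl)) <= K * ((2 + dl) / dl).
Proof.
move=> K0; rewrite sumR_scal; apply: Rmult_le_compat_l => //.
have := npow_tail n dl_gt0 (ltn0Sn 0).
by rewrite {2}/npow ln_1 Rmult_0_r exp_0; lra.
Qed.

(** Truncation enters twice, in the range of [v] and inside the arm and leg. [tannery], with
    majorant [(K + K') v^(-1-dl)], shows that the inner truncation disappears in the limit. *)
Lemma hook_sum_lim k j : (k < N)%N -> (j < N)%N -> exists h,
  Cto (fun n => \sum_(1 <= v < n.+1) hook k j v)%R h /\
  Cto (fun n => \sum_(1 <= v < n.+1) hook_term W0 n k j v)%R h.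
Proof.
move=> lt_k lt_j; have [K K0 bnd] := hook_term_bound; have [K' K'0 bnd'] := hook_bound.
have [|||||h [_ hL]] := @exhaust_HasSum nat (leq 1) (hook k j)
    (fun n => index_iota 1 n.+1) (K' * ((2 + dl) / dl)).
- by move=> n; apply: iota_uniq.
- by move=> n; apply/allP => v; rewrite mem_index_iota => /andP[].
- by move=> n v; rewrite !mem_index_iota => /andP[-> /=]; apply: leqW.
- by move=> v v0; exists v; rewrite mem_index_iota v0 leqnn.
- move=> n; apply: Rle_trans (npow_sum_bound n.+1 K'0); apply: sumR_le => v.
  by rewrite mem_index_iota => /andP[v0 _] _; apply: bnd'.
exists h; split; first by apply: Cto_ext hL => n; rewrite csum_bigE.
have D0 : Cto (fun n => \sum_(1 <= v < n.+1) (hook_term W0 n k j v - hook k j v))%R (RtoC 0).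
  apply: (@tannery _ (fun v => (K + K') * npow v (1 + dl)) ((K + K') * ((2 + dl) / dl))).
  - move=> n v v0; apply: Rle_trans (Cmod_triangle _ _) _.
    rewrite Cmod_opp; have := bnd' k j v lt_k lt_j v0.
    have := bnd W0 n k j v W0_modulus lt_k lt_j v0.
    by lra.
  - by move=> n; apply: npow_sum_bound; lra.
  move=> v v0; have -> : RtoC 0 = (hook k j v - hook k j v)%R by rewrite subrr.
  exact: Cto_add (hook_term_lim lt_k lt_j v0) (Cto_const _).
rewrite -[h]add0r; apply: Cto_ext (Cto_add D0 hL) => n.
by rewrite csum_bigE sumrB; apply: subrK.
Qed.

Let L n := map (diag_tab la) (diag_data la n).
Let Lm n := cart (nseq N (index_iota 1 n.+1)).

Lemma csum_tabs W n :
  csum (L n) (tab_weight W la) =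
  (\sum_(s : 'S_N) (-1) ^+ s *
     \prod_(j < N) \sum_(1 <= v < n.+1) hook_term W n (s^-1 j)%g j v)%R.
Proof.
rewrite csum_bigE (sum_tab_weight W n la_part).
exact: (sum_cart_det_prod _ _
  (fun k : 'I_N => chain 0 n (fun c => W (Z.of_nat c)) (frob_p la k) 0)
  (fun k : 'I_N => chain 1 n (fun c => W (Z.opp (Z.of_nat c))) (frob_q la k) 0)).
Qed.

Lemma schur_summandE T : schur_summand la z T = tab_weight W0 la T.
Proof.
rewrite /schur_summand cprod_bigE; apply: eq_bigr => i _.
by rewrite cprod_bigE.
Qed.

Lemma rhs_summandE n m : m \in Lm n ->
  rhs_summand la z m =
  (\prod_(v <- m) W0 Z0 v * \det (\matrix_(k < N, j < N) F k (nth 0%N m j)) *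
   \prod_(j < N) G j (nth 0%N m j))%R.
Proof.
case/cart_nseqP=> sm Hm; rewrite /rhs_summand -/N cnpow_prodn; last first.
  by apply/allP => v /Hm; rewrite mem_index_iota => /andP[].
rewrite Cmult_assoc; congr (_ * _ * _)%R; last first.
  have -> : iota 0 N = index_iota 0 N by rewrite /index_iota subn0.
  by rewrite cprod_bigE big_mkord.
rewrite csum_bigE big_enum_cond /determinant.
apply: eq_big => [s|s _]; first by rewrite inE.
rewrite cprod_bigE big_enum; congr (_ * _)%R; last by apply: eq_bigr => k _; rewrite mxE.
by rewrite /sgnC; case: odd_perm => //; rewrite expr1; apply: RtoC_opp.
Qed.

Lemma Cmod_sign (s : 'S_N) : Cmod ((-1) ^+ s)%R = 1.
Proof. by case: (odd_perm s); rewrite ?expr1 ?expr0 ?Cmod_opp Cmod_1. Qed.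

Lemma csum_rhs n :
  csum (Lm n) (rhs_summand la z) =
  (\sum_(s : 'S_N) (-1) ^+ s *
     \prod_(j < N) \sum_(1 <= v < n.+1) hook (s^-1 j)%g j v)%R.
Proof.
rewrite csum_bigE -(sum_cart_det_prod _ _ (fun k : 'I_N => F k) (fun k : 'I_N => G k)).
rewrite big_seq [RHS]big_seq; apply: eq_bigr => m; exact: rhs_summandE.
Qed.

(** For the weights [Wabs] the tableau identity turns the absolute sum into a signed sum of products
    of hook sums, bounded uniformly in [n]. *)
Lemma schur_lim : exists S, HasSum (is_SSYT la) (schur_summand la z) S /\
  Cto (fun n => csum (L n) (schur_summand la z)) S.
Proof.
have [K K0 bnd] := hook_term_bound; set B := K * ((2 + dl) / dl).
apply: (@exhaust_HasSum _ _ _ _ (\big[Rplus/0]_(s : 'S_N) pow B N)).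
- move=> n; rewrite map_inj_in_uniq; first exact: diag_data_uniq.
  exact: diag_tab_inj.
- by move=> n; apply/allP => T /(mem_diag_tabs la_part)[].
- move=> n T /(mem_diag_tabs la_part)[ssyt le_n]; apply/(mem_diag_tabs la_part).
  by split=> // i j /le_n; apply: leqW.
- move=> T ssyt; exists (\max_(v <- flatten T) v); apply/(mem_diag_tabs la_part).
  have /SSYTP[sT rT _ _ _] := ssyt; split=> // i j lt_j.
  have lt_i := part_lt_size lt_j.
  apply: (@leq_bigmax_seq _ _ _ id) => //; apply/flattenP; exists (nth [::] T i).
    by rewrite mem_nth ?sT.
  by rewrite /entry mem_nth // rT.
move=> n; have -> : \big[Rplus/0]_(T <- L n) Cmod (schur_summand la z T) =
    Cmod (csum (L n) (tab_weight Wabs la)).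
  have -> : csum (L n) (tab_weight Wabs la) =
      RtoC (\big[Rplus/0]_(T <- L n) Cmod (schur_summand la z T)).
    rewrite csum_bigE RtoC_sum; apply: eq_bigr => T _; rewrite schur_summandE Cmod_prod.
    by apply: eq_bigr => i _; rewrite Cmod_prod.
  by rewrite Cmod_R Rabs_pos_eq //; apply: sumR_ge0 => T; apply: Cmod_ge_0.
rewrite csum_tabs; apply: Cmod_perm_sum_le => [s|s j]; first exact: Cmod_sign.
apply: Rle_trans (Cmod_sum_le _ _ _) _; apply: Rle_trans (npow_sum_bound n.+1 K0).
apply: sumR_le => v; rewrite mem_index_iota => /andP[v0 _] _.
by apply: bnd => //; apply: Wabs_modulus.
Qed.

(** After the determinant is expanded, replacing signs and hooks by moduli leaves, for each
    permutation, a product of bounded one-variable sums. *)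
Lemma rhs_lim : exists S, HasSum (pos_tuple_dom N) (rhs_summand la z) S /\
  Cto (fun n => csum (Lm n) (rhs_summand la z)) S.
Proof.
have [K K0 bnd] := hook_bound; set B := K * ((2 + dl) / dl).
apply: (@exhaust_HasSum _ _ _ _ (\big[Rplus/0]_(s : 'S_N) pow B N)).
- by move=> n; apply/cart_uniq/allP => J /nseqP[-> _]; apply: iota_uniq.
- move=> n; apply/allP => m /cart_nseqP[sm Hm]; rewrite /pos_tuple_dom sm eqxx.
  by apply/allP => v /Hm; rewrite mem_index_iota => /andP[].
- move=> n m /cart_nseqP[sm Hm]; apply/cart_nseqP; split=> // v /Hm.
  by rewrite !mem_index_iota => /andP[-> /=]; apply: leqW.
- move=> m /andP[/eqP sm pos]; exists (\max_(v <- m) v); apply/cart_nseqP; split=> // v vm.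
  by rewrite mem_index_iota (allP pos v vm) ltnS (@leq_bigmax_seq _ _ _ id).
move=> n; pose H (s : 'S_N) (j : 'I_N) v := RtoC (Cmod (hook (s^-1 j)%g j v)).
apply: Rle_trans (_ : Cmod (\sum_(s : 'S_N) RtoC 1 *
    \prod_(j < N) \sum_(1 <= v < n.+1) H s j v)%R <= _).
  have -> : (\sum_(s : 'S_N) RtoC 1 * \prod_(j < N) \sum_(1 <= v < n.+1) H s j v)%R =
     RtoC (\big[Rplus/0]_(m <- Lm n) \big[Rplus/0]_(s : 'S_N)
        Cmod (\prod_(j < N) hook (s^-1 j)%g j (nth 0%N m j))%R).
    rewrite RtoC_sum; under [RHS]eq_bigr do rewrite RtoC_sum.
    rewrite exchange_big /=; apply: eq_bigr => s _; rewrite mul1r -sum_cart_prod_ord.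
    by apply: eq_bigr => m _; rewrite Cmod_prod.
  rewrite Cmod_R; apply: Rle_trans (Rle_abs _); apply: sumR_le => m mL _.
  have [sm _] := cart_nseqP _ _ _ mL.
  rewrite (rhs_summandE mL)
    (det_prod_expand (W0 Z0) (fun k : 'I_N => F k) (fun k : 'I_N => G k) sm).
  apply: Rle_trans (Cmod_sum_le _ _ _) _; apply: sumR_le => s _ _.
  by rewrite Cmod_mult Cmod_sign Rmult_1_l; apply: Rle_refl.
apply: Cmod_perm_sum_le => [s|s j]; first exact: Cmod_1.
apply: Rle_trans (Cmod_sum_le _ _ _) _; apply: Rle_trans (npow_sum_bound n.+1 K0).
apply: sumR_le => v; rewrite mem_index_iota => /andP[v0 _] _.
rewrite Cmod_R Rabs_pos_eq; last exact: Cmod_ge_0.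
exact: bnd.
Qed.

(** Along their exhaustions the two sides are the same polynomial in truncated and in full hook sums
    respectively. [hook_sum_lim] gives both families the same limits [h]. *)
Lemma schur_rhs_HasSum : exists S, HasSum (is_SSYT la) (schur_summand la z) S /\
  HasSum (pos_tuple_dom N) (rhs_summand la z) S.
Proof.
have [S [HS LS]] := schur_lim; have [S' [HS' LS']] := rhs_lim.
have [h hP] : exists h : 'I_N -> 'I_N -> C, forall k j : 'I_N,
    Cto (fun n => \sum_(1 <= v < n.+1) hook k j v)%R (h k j) /\
    Cto (fun n => \sum_(1 <= v < n.+1) hook_term W0 n k j v)%R (h k j).
  have /choice[h hP] : forall kj : 'I_N * 'I_N, exists l,
      Cto (fun n => \sum_(1 <= v < n.+1) hook kj.1 kj.2 v)%R l /\
      Cto (fun n => \sum_(1 <= v < n.+1) hook_term W0 n kj.1 kj.2 v)%R l.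
    by move=> kj; apply: hook_sum_lim.
  by exists (fun k j => h (k, j)) => k j; apply: (hP (k, j)).
pose l := (\sum_(s : 'S_N) (-1) ^+ s * \prod_(j < N) h (s^-1 j)%g j)%R.
have Sl : S = l.
  apply: Cto_unique LS _; rewrite /l.
  apply: (Cto_ext (u := fun n => \sum_(s : 'S_N) (-1) ^+ s *
     \prod_(j < N) \sum_(1 <= v < n.+1) hook_term W0 n (s^-1 j)%g j v)%R).
    move=> n; rewrite -csum_tabs !csum_bigE.
    by apply: eq_bigr => T _; rewrite schur_summandE.
  apply: Cto_sum => s; apply: Cto_mul (Cto_const _) _; apply: Cto_prod => j.
  by case: (hP (s^-1 j)%g j).
have Sl' : S' = l.
  apply: Cto_unique LS' _; rewrite /l.
  apply: (Cto_ext (u := fun n => \sum_(s : 'S_N) (-1) ^+ s *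
     \prod_(j < N) \sum_(1 <= v < n.+1) hook (s^-1 j)%g j v)%R).
    by move=> n; rewrite csum_rhs.
  apply: Cto_sum => s; apply: Cto_mul (Cto_const _) _; apply: Cto_prod => j.
  by case: (hP (s^-1 j)%g j).
by exists l; rewrite -{1}Sl -Sl'.
Qed.

End Limits.

(* A common margin and the convergence statements *)
(* MathComp rebinds the keys [R] and [Z] to its own scopes. *)
Delimit Scope R_scope with R.
Delimit Scope Z_scope with Z.

Theorem theorem4p3 (la : seq nat) (z : Z -> C) :
  is_partition la ->
  (forall i j : nat, in_diagram la i j -> (1 <= Re (z (content i j)))%R) ->
  (forall i : nat, (i < frobN la)%N ->
     (1 < Re (z (Z.of_nat (frob_p la i))))%R /\
     (1 < Re (z (- Z.of_nat (frob_q la i))%Z))%R) ->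
  (forall k : nat, (k < frobN la)%N -> forall x : nat, (0 < x)%N ->
     Summable (zetaBH_dom (frob_p la k))
              (zetaBH_summand (frob_p la k) (fun j => z (Z.of_nat j)) (INR x))) /\
  (forall k : nat, (k < frobN la)%N -> forall x : nat, (0 < x)%N ->
     Summable (zetaH_dom (frob_q la k))
              (zetaBH_summand (frob_q la k) (fun j => z (- Z.of_nat j)%Z) (INR x))) /\
  exists S : C,
    HasSum (is_SSYT la) (schur_summand la z) S /\
    HasSum (pos_tuple_dom (frobN la)) (rhs_summand la z) S.
Proof.
move=> la_part z1 zpq.
(* [dl] is the smallest excess over 1 among the finitely many end exponents, capped by the starting
   value 1 used when there are none. *)
have [dl dl0 dlP] : exists2 dl, 0 < dl & forall i, (i < frobN la)%N ->
    1 + dl <= Re (z (Z.of_nat (frob_p la i))) /\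
    1 + dl <= Re (z (Z.opp (Z.of_nat (frob_q la i)))).
  elim: (frobN la) zpq => [|M IH] zpq; first by exists 1 => //; lra.
  have [dl dl0 dlP] := IH (fun i lt_i => zpq i (ltnW lt_i)).
  have [gt_p gt_q] := zpq M (ltnSn M).
  set a := Re _ in gt_p; set b := Re _ in gt_q.
  have m1 := Rmin_l (a - 1) (b - 1); have m2 := Rmin_r (a - 1) (b - 1).
  have n1 := Rmin_l dl (Rmin (a - 1) (b - 1)).
  have n2 := Rmin_r dl (Rmin (a - 1) (b - 1)).
  exists (Rmin dl (Rmin (a - 1) (b - 1))) => [|i].
    by do 2!apply: Rmin_pos => //; lra.
  rewrite ltnS leq_eqVlt => /predU1P[->|/dlP[]]; first by rewrite -/a -/b; lra.
  by move=> hp hq; split; lra.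
have zp i lt_i := proj1 (dlP i lt_i); have zq i lt_i := proj2 (dlP i lt_i).
(* The first two claims certify that the epsilon-chosen values [zetaBH] and [zetaH] inside
   [rhs_summand] are genuine sums. *)
split; last split.
- move=> k lt_k x x0.
  by have [HS _] := zetaBH_lim la_part dl0 z1 zp lt_k x0; exists (zetaBH (frob_p la k)
    (fun j => z (Z.of_nat j)) (INR x)).
- move=> k lt_k x x0.
  by have [HS _] := zetaH_lim la_part dl0 z1 zq lt_k x0; exists (zetaH (frob_q la k)
    (fun j => z (Z.opp (Z.of_nat j))) (INR x)).
exact: schur_rhs_HasSum la_part dl0 z1 zp zq.
Qed.
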